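(* Let $m\ge2$ and let $(\mathcal T,\mathbf h,\nabla^{\mathcal T},\xi)$ be the standard tractor bundle constructed from a lightlike Cartan geometry $(p:\mathcal P\to N,\omega)$. Given a $1$-form $\tau\in S(N,h^\omega,Z^\omega)$, the tractor connection takes the following form in the decomposition of $\mathcal T$ associated with $\tau$: for $W\in\mathfrak X(N)$, $\alpha,\beta\in C^\infty(N,\mathbb R)$, $X\in\Gamma(\mathrm{An}(\tau))$, $$\nabla^{\mathcal T}_W\begin{pmatrix}\alpha \\ X \\ \beta\end{pmatrix}\overset{\tau}{=}\begin{pmatrix}W(\alpha)+\alpha\,\tau(W)-h^\omega(X,D^\tau(W)) \\ \alpha P^\tau(W)+\beta D^\tau(W)+\nabla^\tau_WX \\ W(\beta)-\beta\,\tau(W)-h^\omega(X,W)\end{pmatrix},$$ where $\nabla^\tau:\mathfrak X(N)\times\Gamma(\mathrm{An}(\tau))\to\Gamma(\mathrm{An}(\tau))$ is a metric linear connection on the vector bundle $(\mathrm{An}(\tau)\to N,h^\omega)$ and $D^\tau:TN\to\mathrm{An}(\tau)$ is a vector bundle morphism.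
   Context: Conventions. Manifolds are smooth, Hausdorff, connected, second countable. $\mathbb L^{m+2}$ is $\mathbb R^{m+2}$ with its Lorentzian inner product $\langle\,,\rangle$ of signature $(m+1,1)$ and a fixed basis $(\ell,e_1,\dots,e_m,n)$ with $\ell$ in the future lightlike cone, $\langle \ell,n\rangle=1$, $\langle e_i,e_j\rangle=\delta_{ij}$ and all other products of basis vectors zero. $G=O^+(m+1,1)$ is the group of linear isometries of $\mathbb L^{m+2}$ preserving the future lightlike cone, $H\subset G$ is the isotropy subgroup of $\ell$, with Lie algebras $\mathfrak h\subset\mathfrak g$. In the fixed basis $\mathfrak g$ consists of the matrices $\begin{pmatrix} a&\zeta&0 \\ X&A&-\zeta^t \\ 0&-X^t&-a\end{pmatrix}$ with $a\in\mathbb R$, $X\in\mathbb R^m$, $\zeta\in(\mathbb R^m)^*$, $A\in\mathfrak o(m)$, and $\mathfrak h$ is given by $a=0,X=0$; so $\mathfrak g/\mathfrak h\cong\mathbb R\times\mathbb R^m$ via $(a,X)$. A lightlike Cartan geometry on an $(m+1)$-dimensional manifold $N$ is a principal bundle $p:\mathcal P\to N$ with structure group $H$ and $\omega\in\Omega^1(\mathcal P,\mathfrak g)$ such that each $\omega(u):T_u\mathcal P\to\mathfrak g$ is a linear isomorphism, $(r^h)^*\omega=\mathrm{Ad}(h^{-1})\circ\omega$ for $h\in H$, and $\omega(\zeta_X)=X$ for the fundamental vector field $\zeta_X$ of each $X\in\mathfrak h$. For $u\in\mathcal P$, $x=p(u)$, let $\phi_u:T_xN\to\mathfrak g/\mathfrak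 h$ be the isomorphism with $\phi_u(T_up\cdot\zeta)=\omega(u)(\zeta)+\mathfrak h$. With $q((a,X),(b,Y))=X^tY$ on $\mathbb R\times\mathbb R^m$, put $h^\omega(v,w)=q(\phi_u v,\phi_u w)$ and $Z^\omega_x=\phi_u^{-1}(1,0)$ (independent of $u$); $h^\omega$ is a lightlike metric (positive semidefinite, one-dimensional radical) and $Z^\omega$ spans its radical. $S(N,h^\omega,Z^\omega)=\{\tau\in\Omega^1(N,\mathbb R):\tau(Z^\omega)=1\}$, $\mathrm{An}(\tau)=\ker\tau\subset TN$ with positive definite metric $h^\omega$, $P^\tau(v)=v-\tau(v)Z^\omega$. Tractor bundle. $\mathcal T=\mathcal P\times_H\mathbb L^{m+2}$ with metric $\mathbf h([u,v_1],[u,v_2])=\langle v_1,v_2\rangle$ and the $\mathbf h$-metric connection $\nabla^{\mathcal T}$ induced by the unique principal connection on $\mathcal P\times_HG$ restricting to $\omega$ on $\mathcal P$; locally $\nabla^{\mathcal T}_W[s,f]=[s,W(f)+\omega(Ts\cdot W)f]$ for a local section $s$ of $\mathcal P$ and an $\mathbb L^{m+2}$-valued function $f$. Put $\xi_x=[u,\ell]$ ($p(u)=x$) and $\Phi(W)=\nabla^{\mathcal T}_W\xi$, a bundle monomorphism $TN\to\mathcal T$ with image $\xi^\perp$, isometric from $h^\omega$ to $\mathbf h$, with $\Phi(Z^\omega)=\xi$. Decomposition. For $\tau\in S(N,h^\omega,Z^\omega)$ let $\eta^\tau$ be the unique lightlike section of $\mathcal T$ with $\mathbf h(\xi,\eta^\tau)=1$,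 $\mathbf h(\Phi(\mathrm{An}(\tau)),\eta^\tau)=0$. The decomposition of $\mathcal T$ associated with $\tau$ identifies $\mathcal T$ with $\underline{\mathbb R}\oplus\mathrm{An}(\tau)\oplus\underline{\mathbb R}$ by $\alpha\xi+\Phi(X)+\beta\eta^\tau\leftrightarrow(\alpha,X,\beta)^t$, $X\in\Gamma(\mathrm{An}(\tau))$; $\overset{\tau}{=}$ denotes equality under this identification. *)

(* Defs.v *)
From HB Require Import structures.
From mathcomp Require Import all_boot all_order all_algebra.
From mathcomp Require Import all_classical all_reals all_analysis.

Set Implicit Arguments.
Unset Strict Implicit.
Unset Printing Implicit Defensive.

Import Order.TTheory GRing.Theory Num.Theory.
Import numFieldNormedType.Exports.

Local Open Scope classical_set_scope.
Local Open Scope ring_scope.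

Section SmoothOn.
Context {R : realType} {V W : normedModType R}.

(* Meant for open [U] and finite-dimensional [V], [W]: there, a differentiable
   map all of whose directional derivatives are C^k is exactly a C^(k+1) map. *)
Fixpoint Ck_on (k : nat) (U : set V) (f : V -> W) : Prop :=
  if k is k'.+1 then
    (forall x, U x -> differentiable f x) /\
    (forall v : V, Ck_on k' U (fun x => 'D_v f x))
  else forall x, U x -> {for x, continuous f}.

Definition smooth_on (U : set V) (f : V -> W) : Prop := forall k, Ck_on k U f.

End SmoothOn.

Record chart (R : realType) (M : topologicalType) (n : nat) := Chart {
  cdom : set M;
  cmap :> M -> 'rV[R]_n;
  cinv : 'rV[R]_n -> M;
  cdom_open : open cdom;
  cimg_open : open (cmap @` cdom);
  cmapK : forall x, cdom x -> cinv (cmap x) = x;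
  cmap_continuous : forall x, cdom x -> {for x, continuous cmap};
  cinv_continuous : forall x, cdom x -> {for cmap x, continuous cinv}
}.

(* Connectedness is not part of the record: the total space of a principal
   bundle with a disconnected structure group need not be connected. *)
Record manifold (R : realType) (n : nat) := Manifold {
  mcarrier :> topologicalType;
  atlas : set (chart R mcarrier n);
  atlas_cover : forall x : mcarrier, exists2 c, atlas c & cdom c x;
  atlas_compat : forall c c', atlas c -> atlas c' ->
    smooth_on (c @` (cdom c `&` cdom c')) (c' \o cinv c);
  manifold_hausdorff : hausdorff_space mcarrier;
  manifold_second_countable : @second_countable mcarrier
}.

Section Manifolds.
Context {R : realType}.

Definition chart_at n (M : manifold R n) (x : M) : chart R M n :=
  sval (cid2 (atlas_cover x)).

(* The tangent space T_xM is modelled on R^n through the chart [chart_at x]: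
   [v : 'rV_n] stands for the vector with coordinates [v] in that chart.  All
   the differentials below are computed in these coordinates. *)

(* d_xf : T_xM -> V for a function f with values in a normed space V. *)
Definition dfun n (M : manifold R n) (V : normedModType R) (f : M -> V)
    (x : M) (v : 'rV[R]_n) : V :=
  'd (f \o cinv (chart_at x)) (chart_at x x) v.

(* T_xf : T_xM -> T_(f x)M'. *)
Definition tmap n n' (M : manifold R n) (M' : manifold R n') (f : M -> M')
    (x : M) (v : 'rV[R]_n) : 'rV[R]_n' :=
  dfun (chart_at (f x) \o f) x v.

(* The velocity at t of a curve g : R -> M, in T_(g t)M. *)
Definition velocity n (M : manifold R n) (g : R -> M) (t : R) : 'rV[R]_n :=
  'D_1 (chart_at (g t) \o g) t.

(* The vector at the point x with coordinates e in the chart c. *)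
Definition coord_vec n (M : manifold R n) (c : chart R M n) (x : M)
    (e : 'rV[R]_n) : 'rV[R]_n :=
  'd (chart_at x \o cinv c) (c x) e.

Definition smooth_fun_on n (M : manifold R n) (V : normedModType R)
    (U : set M) (f : M -> V) : Prop :=
  forall c, atlas c -> smooth_on (c @` (cdom c `&` U)) (f \o cinv c).

Definition smooth_fun n (M : manifold R n) (V : normedModType R) (f : M -> V) :
  Prop := smooth_fun_on setT f.

Definition smooth_map n n' (M : manifold R n) (M' : manifold R n')
    (f : M -> M') : Prop :=
  continuous f /\
  forall c c', atlas c -> atlas c' ->
    smooth_on (c @` (cdom c `&` f @^-1` cdom c')) (c' \o f \o cinv c).

(* Smoothness of f : U x S -> M', for U open in M and S an embedded submanifold
   (not open in general) of V: near every point of U x S, f agrees on U x S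
   with a smooth map F defined on an open subset of M x V. *)
Definition smooth_prod_on n n' (M : manifold R n) (V : normedModType R)
    (M' : manifold R n') (U : set M) (S : set V) (f : M -> V -> M') : Prop :=
  forall x h, U x -> S h -> exists (F : M -> V -> M') (A : set M) (B : set V),
    [/\ open A /\ A x, open B /\ B h,
        forall x' h', A x' -> U x' -> B h' -> S h' -> F x' h' = f x' h',
        forall x' h', A x' -> B h' ->
          {for (x', h'), continuous (fun z : M * V => F z.1 z.2)} &
        forall c c', atlas c -> atlas c' ->
          smooth_on [set z : 'rV[R]_n * V |
                      [/\ (c @` (cdom c `&` A)) z.1, B z.2 &
                          cdom c' (F (cinv c z.1) z.2)]]
                    (fun z => c' (F (cinv c z.1) z.2))].

(* Vector fields, V-valued 1-forms and endomorphisms of TM are smooth when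
   their components in the charts of the atlas are. *)
Definition smooth_vfield n (M : manifold R n) (X : M -> 'rV[R]_n) : Prop :=
  forall c, atlas c -> smooth_fun_on (cdom c) (fun x => dfun c x (X x)).

Definition smooth_form n (M : manifold R n) (V : normedModType R)
    (w : M -> 'rV[R]_n -> V) : Prop :=
  (forall x, linear (w x)) /\
  forall c, atlas c -> forall e : 'rV[R]_n,
    smooth_fun_on (cdom c) (fun x => w x (coord_vec c x e)).

Definition smooth_endo n (M : manifold R n)
    (D : M -> 'rV[R]_n -> 'rV[R]_n) : Prop :=
  (forall x, linear (D x)) /\
  forall c, atlas c -> forall e : 'rV[R]_n,
    smooth_fun_on (cdom c) (fun x => dfun c x (D x (coord_vec c x e))).

End Manifolds.

Section Lorentz.
Context {R : realType} {m : nat}.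

(* Coordinates are taken in the basis (ell, e_1, ..., e_m, n). *)
Local Notation L := 'cV[R]_(1 + (m + 1)).
Local Notation Mat := 'M[R]_(1 + (m + 1)).

Definition lcol (a : R) (X : 'cV[R]_m) (b : R) : L :=
  col_mx a%:M (col_mx X b%:M).

Definition ell : L := lcol 1 0 0.

Definition nvec : L := lcol 0 0 1.

Definition gram : Mat :=
  block_mx 0 (row_mx 0 1%:M) (col_mx 0 1%:M) (block_mx 1%:M 0 0 0).

Definition lprod (v w : L) : R := (v^T *m gram *m w) 0 0.

(* ell - n is timelike and in the same half as ell, as <ell, ell - n> < 0. *)
Definition future_cone : set L :=
  [set v | lprod v v = 0 /\ lprod v (ell - nvec) < 0].

Definition Gset : set Mat :=
  [set A | (forall v w, lprod (A *m v) (A *m w) = lprod v w) /\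
           [set A *m v | v in future_cone] = future_cone].

Definition Hset : set Mat := [set A | Gset A /\ A *m ell = ell].

Definition gmat (a : R) (z : 'rV[R]_m) (X : 'cV[R]_m) (A : 'M[R]_m) : Mat :=
  block_mx a%:M (row_mx z 0)
           (col_mx X 0) (block_mx A (- z^T) (- X^T) (- a%:M)).

Definition gLie : set Mat :=
  [set M | exists a z X (A : 'M[R]_m), A^T = - A /\ M = gmat a z X A].

Definition hLie : set Mat :=
  [set M | exists z (A : 'M[R]_m), A^T = - A /\ M = gmat 0 z 0 A].

(* The projection gLie -> gLie / hLie ~ R x R^m. *)
Definition gh_proj (M : Mat) : R * 'cV[R]_m :=
  (ulsubmx M 0 0, usubmx (dlsubmx M)).

Definition qform (s t : R * 'cV[R]_m) : R := (s.2^T *m t.2) 0 0.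

End Lorentz.

Arguments Gset : clear implicits.
Arguments Hset : clear implicits.
Arguments gLie : clear implicits.
Arguments hLie : clear implicits.

Record principal_Hbundle (R : realType) (m k : nat) (N : manifold R m.+1) :=
  PrincipalHBundle {
  total :> manifold R k;
  proj : total -> N;
  (* only the values at [h \in H] matter *)
  act : total -> 'M[R]_(1 + (m + 1)) -> total;
  proj_smooth : smooth_map proj;
  proj_surj : forall x, exists u, proj u = x;
  act_smooth : smooth_prod_on setT (Hset R m) act;
  act1 : forall u, act u 1%:M = u;
  actM : forall u h h', Hset R m h -> Hset R m h' ->
    act u (h *m h') = act (act u h) h';
  act_proj : forall u h, Hset R m h -> proj (act u h) = proj u;
  act_free : forall u h, Hset R m h -> act u h = u -> h = 1%:M;
  act_trans : forall u u', proj u = proj u' ->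
    exists2 h, Hset R m h & u' = act u h;
  (* u |-> (proj u, g u) is an equivariant diffeomorphism from proj^-1(U) to
     U x H, with inverse Psi *)
  local_triv : forall x, exists (U : set N)
      (g : total -> 'M[R]_(1 + (m + 1))) (Psi : N -> 'M[R]_(1 + (m + 1)) -> total),
    [/\ open U /\ U x,
        smooth_fun_on (proj @^-1` U) g,
        smooth_prod_on U (Hset R m) Psi,
        forall u, U (proj u) ->
          [/\ Hset R m (g u), Psi (proj u) (g u) = u &
              forall h, Hset R m h -> g (act u h) = g u *m h] &
        forall y h, U y -> Hset R m h ->
          proj (Psi y h) = y /\ g (Psi y h) = h]
}.

Section Cartan.
Context {R : realType} {m k : nat} {N : manifold R m.+1}.
Variable P : principal_Hbundle k N.

Local Notation L := 'cV[R]_(1 + (m + 1)).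
Local Notation Mat := 'M[R]_(1 + (m + 1)).
Local Notation TN := 'rV[R]_m.+1.
Local Notation TP := 'rV[R]_k.

(* z is the value at u of the fundamental vector field of X, i.e. the image of
   X (an element of T_1 H, represented by a curve in H) under the differential
   at 1 of h |-> u.h *)
Definition is_fundamental (u : P) (X : Mat) (z : TP) : Prop :=
  exists c : R -> Mat,
    [/\ smooth_on setT c, forall t, Hset R m (c t), c 0 = 1%:M,
        'D_1 c 0 = X & z = velocity (fun t => act u (c t)) 0].

Definition lightlike_cartan (omega : P -> TP -> Mat) : Prop :=
  [/\ smooth_form omega,
      forall u, set_bij setT (gLie R m) (omega u),
      forall u h z, Hset R m h ->
        omega (act u h) (tmap (fun u' => act u' h : P) u z)
        = invmx h *m omega u z *m h &
      forall u X z, hLie R m X -> is_fundamental u X z -> omega u z = X].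

Variable omega : P -> TP -> Mat.

(* Some vector of T_uP over v in T_(proj u)N. *)
Definition lift (u : P) (v : TN) : TP :=
  xget 0 [set z | tmap (@proj _ _ _ _ P) u z = v].

Definition fibre_pt (x : N) : P := sval (cid (proj_surj P x)).

Definition phi (u : P) (v : TN) : R * 'cV[R]_m := gh_proj (omega u (lift u v)).

Definition hmet (x : N) (v w : TN) : R :=
  qform (phi (fibre_pt x) v) (phi (fibre_pt x) w).

Definition Zvec (x : N) : TN :=
  xget 0 [set v | phi (fibre_pt x) v = (1, 0)].

Definition Sforms : set (N -> TN -> R) :=
  [set tau | smooth_form (tau : N -> TN -> R^o) /\
             forall x, tau x (Zvec x) = 1].

Definition An (tau : N -> TN -> R) (x : N) : set TN := [set v | tau x v = 0].

Definition An_section (tau : N -> TN -> R) (X : N -> TN) : Prop :=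
  smooth_vfield X /\ forall x, An tau x (X x).

Definition Ptau (tau : N -> TN -> R) (x : N) (v : TN) : TN :=
  v - tau x v *: Zvec x.

(* The element [u, v] of P x_H L, as an orbit in P * L. *)
Definition bracket (u : P) (v : L) : set (P * L) :=
  [set (act u h, invmx h *m v) | h in Hset R m].

(* A section s of P x_H L is represented by the H-equivariant function
   f : P -> L such that s (proj u) = [u, f u]; addition and scaling of sections
   are the pointwise ones, and the metric of [u, v], [u, w] is lprod v w. *)
Definition tractor_section (f : P -> L) : Prop :=
  smooth_fun f /\ forall u h, Hset R m h -> f (act u h) = invmx h *m f u.

(* The class [u, f u] is the graph of f over the fibre through u. *)
Lemma bracketE (f : P -> L) (u : P) : tractor_section f ->
  bracket u (f u) = [set (u', f u') | u' in [set u' | proj u' = proj u]].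
Proof.
move=> [_ fH]; apply/seteqP; split => [_ [h Hh <-]|_ [u' /= pu' <-]].
  by exists (act u h); [exact: act_proj | rewrite fH].
have [h Hh ->] := act_trans (esym pu').
by exists h => //; rewrite fH.
Qed.

(* The derivative along v of the section [u, f u].  For a local section s of P
   one has [s, W(f o s) + omega(Ts.W) (f o s)] at u = s x, where z := Ts.W x is
   a lift of W x, and W(f o s) = d_uf z; the value does not depend on the lift. *)
Definition nabla_at (u : P) (v : TN) (f : P -> L) : L :=
  dfun f u (lift u v) + omega u (lift u v) *m f u.

Definition nablaT (W : N -> TN) (f : P -> L) : P -> L :=
  fun u => nabla_at u (W (proj u)) f.

Definition xi : P -> L := fun=> ell.

Definition Phi_at (u : P) (v : TN) : L := nabla_at u v xi.

Definition Phi (W : N -> TN) : P -> L := fun u => Phi_at u (W (proj u)).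

Definition is_eta (tau : N -> TN -> R) (eta : P -> L) : Prop :=
  [/\ tractor_section eta,
      forall u, lprod (eta u) (eta u) = 0,
      forall u, lprod (xi u) (eta u) = 1 &
      forall u v, An tau (proj u) v -> lprod (Phi_at u v) (eta u) = 0].

Definition eta (tau : N -> TN -> R) : P -> L :=
  xget (fun=> 0) [set e | is_eta tau e].

(* The section with components (alpha, X, beta) in the decomposition of the
   tractor bundle associated with tau. *)
Definition decomp (tau : N -> TN -> R) (alpha : N -> R) (X : N -> TN)
    (beta : N -> R) : P -> L :=
  fun u => alpha (proj u) *: xi u + Phi X u + beta (proj u) *: eta tau u.

(* The derivative W(f) of a real function on N. *)
Definition vder (W : N -> TN) (f : N -> R) : N -> R :=
  fun x => dfun (f : N -> R^o) x (W x).

Definition smoothR (f : N -> R) : Prop := smooth_fun (f : N -> R^o).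

Definition linear_connection_An (tau : N -> TN -> R)
    (D : (N -> TN) -> (N -> TN) -> (N -> TN)) : Prop :=
  [/\ forall W X, smooth_vfield W -> An_section tau X -> An_section tau (D W X),
      forall W W' X f, smooth_vfield W -> smooth_vfield W' -> smoothR f ->
        An_section tau X ->
        forall x, D (fun y => f y *: W y + W' y) X x = f x *: D W X x + D W' X x,
      forall W X Y, smooth_vfield W -> An_section tau X -> An_section tau Y ->
        forall x, D W (fun y => X y + Y y) x = D W X x + D W Y x &
      forall W X f, smooth_vfield W -> smoothR f -> An_section tau X ->
        forall x, D W (fun y => f y *: X y) x
                  = vder W f x *: X x + f x *: D W X x].

Definition metric_connection_An (tau : N -> TN -> R)
    (D : (N -> TN) -> (N -> TN) -> (N -> TN)) : Prop :=
  linear_connection_An tau D /\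
  forall W X Y, smooth_vfield W -> An_section tau X -> An_section tau Y ->
    forall x, vder W (fun y => hmet y (X y) (Y y)) x
              = hmet x (D W X x) (Y x) + hmet x (X x) (D W Y x).

Definition bundle_morphism_An (tau : N -> TN -> R) (D : N -> TN -> TN) : Prop :=
  smooth_endo D /\ forall x v, An tau x (D x v).

End Cartan.

(* Main.v *)
(* A section of the tractor bundle is an H-equivariant function f : P -> L, and
   its derivative is d_u f (z) + omega(z) f(u) for any lift z of the vector: a
   vertical z is fundamental, and there the two terms cancel by equivariance.
   Hence v |-> Phi_at u v identifies T_xN with ell^perp, and eta is the null
   vector dual to ell that represents tau on it.  Since omega takes values in
   the Lorentz algebra, the derivative is metric; differentiating the constants
   <eta, eta> = 0, <ell, eta> = 1, <Phi X, eta> = 0 and <ell, Phi X> = 0 gives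
   every component of the formula except the An(tau)-parts of the derivatives
   of eta and Phi X, which define D and nabla.
   Smoothness is tested on P, where omega has a smooth inverse, and descends to
   N along local sections. *)
From HB Require Import structures.
Require Import Defs.
From mathcomp Require Import all_boot all_order all_algebra.
From mathcomp Require Import all_classical all_reals all_analysis.
From mathcomp Require Import ring lra.
Import Order.TTheory GRing.Theory Num.Theory.
Import numFieldNormedType.Exports.
Local Open Scope classical_set_scope.
Local Open Scope ring_scope.

Set Implicit Arguments.
Unset Strict Implicit.
Unset Printing Implicit Defensive.

(** * Calculus of C^k maps in finite dimension *)

Section CkCalculus.
Context {R : realType}.
Implicit Types V W Z : normedModType R.

(** The axiom on fundamental fields speaks only of orbits of smooth curves that stay in H at all
    times, and a vertical vector does not come with such a curve. One is built from a local
    trivialisation, whose group coordinate turns a path in P into a path in H. The same construction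
    gives [omega] on a vertical vector as the logarithmic derivative of the group coordinate, and
    this is what cancels the derivative of an equivariant function. Lifts, Z, D and nabla are
    pointwise choices and carry no regularity by themselves. Either the choice drops out, as it does
    for lifts, or the chosen value is the unique solution of an equation on P with equivariant
    right-hand side. Smooth solutions of the linear systems that occur come from explicit one-sided
    inverses of matrices in charts. Tangent vectors at nearby points are written in unrelated
    charts, so a field of vectors is tested for smoothness only after conversion to one fixed
    chart. *)

Lemma near_eq_differentiable V W (f g : V -> W) (x : V) :
  (\near x, f x = g x) -> differentiable f x -> differentiable g x.
Proof.
move=> fg df.
have fgx : f x = g x by exact: (nbhs_singleton fg).
(* The differential of [f] satisfies the first-order expansion of [g] at [x]; uniqueness then makes
   it the differential of [g]. *)
have hg : g \o shift x = cst (g x) + 'd f x +o_ 0 id.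
  apply/eqaddoP => _/posnumP[e].
  have /eqaddoP /(_ e%:num) /(_ [gt0 of e%:num]) := diff_locally df.
  have : \forall h \near (0 : V), f (h + x) = g (h + x).
    by move: fg; rewrite (near_shift 0) /=; apply: filterS => h /=; rewrite subr0.
  move=> fg0; apply: filterS2 fg0 => h /= fgh.
  by rewrite /= -![(_ - _ : _ -> _) _]/(_ - _) /= /cst fgh fgx.
apply/diff_locallyP.
have cf : continuous ('d f x) by exact: diff_continuous.
by rewrite (diff_unique cf hg).
Qed.

Lemma near_eq_diff V W (f g : V -> W) (x : V) :
  (\near x, f x = g x) -> differentiable f x -> 'd f x = 'd g x :> (V -> W).
Proof.
move=> fg df; apply/funext => v.
have dg := near_eq_differentiable fg df.
by rewrite -!deriveE //; exact: near_eq_derive.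
Qed.

Lemma Ck_on_sub k V W (U U' : set V) (f : V -> W) :
  U' `<=` U -> Ck_on k U f -> Ck_on k U' f.
Proof.
move=> sU; elim: k f => [|k IH] f /=; first by move=> cf x /sU /cf.
by move=> [df cf]; split=> [x /sU /df //|v]; apply: IH.
Qed.

Lemma Ck_on_eq k V W (U : set V) (f g : V -> W) : open U ->
  (forall x, U x -> f x = g x) -> Ck_on k U f -> Ck_on k U g.
Proof.
move=> oU; have nU x : U x -> \near x, U x by move=> Ux; exact: open_nbhs_nbhs.
elim: k f g => [|k IH] f g fg /=.
  move=> cf x Ux; rewrite /prop_for /continuous_at -(fg x Ux).
  apply: cvg_trans (cf x Ux); apply: near_eq_cvg.
  by apply: filterS (nU x Ux) => y /fg.
have nfg x : U x -> \near x, f x = g x by move=> /nU; apply: filterS.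
move=> [df cf]; split=> [x Ux|v].
  exact: near_eq_differentiable (nfg x Ux) (df x Ux).
by apply: IH (cf v) => x Ux; exact: near_eq_derive (nfg x Ux).
Qed.

Lemma Ck_onW k V W (U : set V) (f : V -> W) : Ck_on k.+1 U f -> Ck_on k U f.
Proof.
elim: k f => [|k IH] f [df cf]; first by move=> x /df /differentiable_continuous.
by split=> // v; apply: IH.
Qed.

Lemma Ck_on_cst k V W (U : set V) (a : W) : Ck_on k U (cst a).
Proof.
elim: k a => [|k IH] a /=; first by move=> x _; exact: cst_continuous.
split=> [x _|v]; first exact: differentiable_cst.
have -> : (fun x => 'D_v (cst a) x) = cst 0 by apply/funext => x; exact: derive_cst.
exact: IH.
Qed.

Lemma Ck_on_linear k V W (U : set V) (f : {linear V -> W}) :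
  continuous f -> Ck_on k U f.
Proof.
move=> cf; case: k => [|k] /=; first by move=> x _; exact: cf.
split=> [x _|v]; first exact: linear_differentiable.
have -> : (fun x => 'D_v f x) = cst (f v).
  apply/funext => x; rewrite deriveE; last exact: linear_differentiable.
  by rewrite diff_lin.
exact: Ck_on_cst.
Qed.

Lemma Ck_on_lin_comp k V W Z (U : set V) (f : V -> W) (l : {linear W -> Z}) :
  open U -> continuous l -> Ck_on k U f -> Ck_on k U (l \o f).
Proof.
move=> oU cl; elim: k f => [|k IH] f /=.
  by move=> cf x Ux; apply: continuous_comp; [exact: cf | exact: cl].
have dl y : differentiable l y by exact: linear_differentiable.
move=> [df cf]; split=> [x Ux|v]; first exact: differentiable_comp (df x Ux) _.
apply: Ck_on_eq oU _ (IH _ (cf v)) => x Ux /=.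
have dfx := df x Ux.
rewrite !deriveE //; last exact: differentiable_comp.
by rewrite [in RHS]diff_comp //= diff_lin.
Qed.

Lemma Ck_onD k V W (U : set V) (f g : V -> W) :
  open U -> Ck_on k U f -> Ck_on k U g -> Ck_on k U (fun x => f x + g x).
Proof.
move=> oU; elim: k f g => [|k IH] f g /=.
  by move=> cf cg x Ux; apply: continuousD; [exact: cf | exact: cg].
move=> [df cf] [dg cg]; split=> [x Ux|v].
  by apply: differentiableD; [exact: df | exact: dg].
apply: Ck_on_eq oU _ (IH _ _ (cf v) (cg v)) => x Ux /=.
by rewrite -[RHS]/('D_v (f + g) x) deriveD //; apply: diff_derivable; [exact: df | exact: dg].
Qed.

Lemma Ck_on_sum k V W (U : set V) I (r : seq I) (p : pred I) (f : I -> V -> W) :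
  open U -> (forall i, p i -> Ck_on k U (f i)) ->
  Ck_on k U (fun x => \sum_(i <- r | p i) f i x).
Proof.
move=> oU cf; elim: r => [|i r IH].
  by under eq_fun do rewrite big_nil; exact: Ck_on_cst.
under eq_fun do rewrite big_cons.
by case pi: (p i) => //; apply: Ck_onD => //; exact: cf.
Qed.

Lemma Ck_onM k V (U : set V) (f g : V -> R) :
  open U -> Ck_on k U (f : V -> R^o) -> Ck_on k U (g : V -> R^o) ->
  Ck_on k U ((fun x => f x * g x) : V -> R^o).
Proof.
move=> oU; elim: k f g => [|k IH] f g.
  by move=> cf cg x Ux; apply: continuousM; [exact: cf | exact: cg].
(* The product rule contains [f] and [g] themselves next to their derivatives, so both are kept at
   the lower order k for the induction hypothesis. *)
move=> cf' cg'; have cf1 := Ck_onW cf'; have cg1 := Ck_onW cg'.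
move: cf' cg' => /= [df cf] [dg cg]; split=> [x Ux|v].
  by apply: differentiableM; [exact: df | exact: dg].
have := Ck_onD oU (IH _ _ cf1 (cg v)) (IH _ _ cg1 (cf v)). apply: (Ck_on_eq oU) => x Ux /=.
by rewrite -[RHS]/('D_v (f * g) x) deriveM //; apply: diff_derivable; [exact: df | exact: dg].
Qed.

(** The derivative of 1/f is -(1/f)^2 times that of f, so the inverse itself, known at order k, is
    fed back to reach order k+1. *)
Lemma Ck_onV k V (U : set V) (f : V -> R) :
  open U -> (forall x, U x -> f x != 0) -> Ck_on k U (f : V -> R^o) ->
  Ck_on k U ((fun x => (f x)^-1) : V -> R^o).
Proof.
move=> oU f0; elim: k => [|k IH].
  by move=> cf x Ux; apply: continuousV; [exact: f0 | exact: cf].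
move=> cf'; have cf1 := IH (Ck_onW cf').
move: cf' => /= [df cf]; split=> [x Ux|v].
  by apply: differentiableV; [exact: df | exact: f0].
have := Ck_onM oU (@Ck_on_cst _ _ R^o _ (-1 : R)) (Ck_onM oU (Ck_onM oU cf1 cf1) (cf v)).
apply: (Ck_on_eq oU) => x Ux /=.
rewrite -[RHS]/('D_v (fun x => (f x)^-1) x) deriveV ?f0 //;
  last by apply: diff_derivable; exact: df.
by rewrite mulN1r -exprVn expr2 scaleNr.
Qed.

Lemma Ck_onZ k V W (U : set V) (f : V -> R) (g : V -> W) :
  open U -> Ck_on k U (f : V -> R^o) -> Ck_on k U g ->
  Ck_on k U (fun x => f x *: g x).
Proof.
move=> oU; elim: k f g => [|k IH] f g.
  by move=> cf cg x Ux; apply: continuousZ; [exact: cf | exact: cg].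
move=> cf' cg'; have cf1 := Ck_onW cf'; have cg1 := Ck_onW cg'.
(* Scaling is packed as a continuous bilinear map, so that [diff_bilin] supplies its product
   rule. *)
have bs : bilinear_for (GRing.Scale.Law.clone _ _ *:%R _)
    (GRing.Scale.Law.clone _ _ *:%R _) (fun (a : R^o) (w : W) => a *: w).
  by split=> [w|a] b y z /=; rewrite ?scalerDl ?scalerDr !scalerA // mulrC.
pose sM := bilinear_isBilinear.Build R R^o W W _ _ (fun (a : R^o) (w : W) => a *: w) bs.
pose s : {bilinear R^o -> W -> W} := HB.pack (fun (a : R^o) (w : W) => a *: w) sM.
have cs : continuous (fun p : R^o * W => s p.1 p.2) by exact: scale_continuous.
move: cf' cg' => /= [df cf] [dg cg].
have dp x : U x -> differentiable (fun x => (f x : R^o, g x)) x.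
  by move=> Ux; apply: differentiable_pair; [exact: df | exact: dg].
have ds p := differentiable_bilin p cs.
split=> [x Ux|v]; first exact: (differentiable_comp (dp x Ux) (ds _)).
have := Ck_onD oU (IH _ _ cf1 (cg v)) (IH _ _ (cf v) cg1).
apply: (Ck_on_eq oU) => x Ux /=.
rewrite [RHS]deriveE; last exact: (differentiable_comp (dp x Ux) (ds _)).
have := diff_comp (dp x Ux) (ds _); rewrite diff_bilin // diff_pair; [|exact: df|exact: dg].
move=> /(congr1 (@^~ v)) /= ->.
by rewrite !deriveE //; [exact: df | exact: dg].
Qed.

(** This is the form in which a differential ['d f x v] splits into derivatives along the constant
    vectors [e i], the only ones [Ck_on] speaks of. *)
Definition findim V := exists (I : finType) (e : I -> V) (l : I -> {linear V -> R^o}),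
  (forall i, continuous (l i)) /\ forall v, v = \sum_i l i v *: e i.

Lemma linear_packed V W (f : V -> W) : linear f ->
  exists g : {linear V -> W}, f = g.
Proof.
move=> lf; pose fM := GRing.isLinear.Build R V W _ f lf.
pose g : {linear V -> W} := HB.pack f fM.
by exists g.
Qed.

Lemma findim_linear_continuous V W (f : V -> W) :
  findim V -> linear f -> continuous f.
Proof.
move=> [I [e [l [cl el]]]] /linear_packed[g ->].
have -> : (g : V -> W) = fun v => \sum_i l i v *: g (e i).
  by apply/funext => v; rewrite {1}(el v) linear_sum; apply: eq_bigr => i _; rewrite linearZ.
move=> v; apply: (@Ck_on_sum 0 V W setT I _ xpredT) => //; first exact: openT.
move=> i _ w _ /=; apply: continuousZ; [exact: cl | exact: cst_continuous].
Qed.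

Lemma findim_mx m n : findim 'M[R]_(m, n).
Proof.
have lin ij : linear (fun M : 'M[R]_(m, n) => M ij.1 ij.2 : R^o).
  by move=> a A B; rewrite !mxE.
pose c (ij : 'I_m * 'I_n) (M : 'M[R]_(m, n)) : R^o := M ij.1 ij.2.
pose lM ij := GRing.isLinear.Build R 'M[R]_(m, n) R^o _ (c ij) (lin ij).
exists ('I_m * 'I_n)%type, (fun ij => delta_mx ij.1 ij.2).
pose l ij : {linear 'M[R]_(m, n) -> R^o} := HB.pack (c ij) (lM ij).
exists l; split=> /= [ij|v].
  exact: coord_continuous.
by rewrite {1}(matrix_sum_delta v) pair_bigA.
Qed.

Lemma findim_R : findim R^o.
Proof.
exists unit, (fun=> 1), (fun=> idfun); split=> [_ x|v]; first exact: cvg_id.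
by rewrite big_const card_unit /= addr0 /GRing.scale /= mulr1.
Qed.

Lemma findim_prod V W : findim V -> findim W -> findim (V * W)%type.
Proof.
move=> [I [e [l [cl el]]]] [J [e' [l' [cl' el']]]].
pose c (k : I + J) (z : V * W) : R^o := match k with inl i => l i z.1 | inr j => l' j z.2 end.
have lin k : linear (c k) by case: k => i a x y /=; rewrite linearP.
pose lM k := GRing.isLinear.Build R (V * W)%type R^o _ (c k) (lin k).
exists (I + J)%type, (fun k => match k with inl i => (e i, 0) | inr j => (0, e' j) end).
pose L k : {linear (V * W)%type -> R^o} := HB.pack (c k) (lM k).
exists L; split=> [[i|j] z|[v w]] /=.
- by apply: (@continuous_comp _ _ _ fst (l i)); [exact: cvg_fst | exact: cl].
- by apply: (@continuous_comp _ _ _ snd (l' j)); [exact: cvg_snd | exact: cl'].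
rewrite big_sumType /=.
have -> : \sum_i l i v *: (e i, 0 : W) = (v, 0).
  rewrite [in RHS](el v); elim/big_rec2: _ => // i a b _ ->.
  by apply: injective_projections; rewrite /= ?scaler0 ?add0r.
have -> : \sum_i l' i w *: (0 : V, e' i) = (0, w).
  rewrite [in RHS](el' w); elim/big_rec2: _ => // i a b _ ->.
  by apply: injective_projections; rewrite /= ?scaler0 ?add0r.
by apply: injective_projections; rewrite /= ?addr0 ?add0r.
Qed.

(** [Ck_on] controls derivatives along constant directions, whereas the chain rule differentiates
    [h] along the varying vector ['D_v f x]. Expanding that vector in coordinates gives a sum of
    terms l_i(D_v f) (D_(e_i) h) o f, and the induction hypothesis applies to each. *)
Lemma Ck_on_comp k V W Z (U : set V) (U' : set W) (f : V -> W) (h : W -> Z) :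
  findim W -> open U -> (forall x, U x -> U' (f x)) ->
  Ck_on k U f -> Ck_on k U' h -> Ck_on k U (h \o f).
Proof.
move=> [I [e [l [cl el]]]] oU fU; elim: k h => [|k IH] h.
  by move=> cf ch x Ux; apply: continuous_comp; [exact: cf | exact/ch/fU].
move=> cf' ch'; have cf1 := Ck_onW cf'.
move: cf' ch' => /= [df cf] [dh ch].
have dc x : U x -> differentiable (h \o f) x.
  by move=> Ux; apply: differentiable_comp; [exact: df | exact/dh/fU].
split=> // v.
have := @Ck_on_sum k V Z U I (index_enum I) xpredT _ oU (fun i _ =>
  Ck_onZ oU (Ck_on_lin_comp oU (cl i) (cf v)) (IH _ cf1 (ch (e i)))).
apply: (Ck_on_eq oU) => x Ux /=.
rewrite [RHS]deriveE; last exact: dc.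
rewrite diff_comp; [|exact: df|exact/dh/fU].
rewrite /= [in RHS](el ('d f x v)) linear_sum; apply: eq_bigr => i _.
by rewrite linearZ /= !deriveE //; [exact/dh/fU | exact: df].
Qed.

End CkCalculus.

(** * Germs of smooth maps, matrix inverses, varying differentials *)

Section SmoothAt.
Context {R : realType}.
Implicit Types V W Z : normedModType R.

Definition smooth_at V W (f : V -> W) (x : V) : Prop :=
  exists U : set V, [/\ open U, U x & smooth_on U f].

Lemma smooth_onP V W (U : set V) (f : V -> W) : open U ->
  smooth_on U f <-> forall x, U x -> smooth_at f x.
Proof.
move=> oU; split=> [sf x Ux|sf k]; first by exists U.
(* For a fixed order k, being C^k near each point passes to the directional derivatives, so this
   form survives the induction. *)
have {sf} : forall x, U x -> exists A, [/\ open A, A x & Ck_on k A f].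
  by move=> x /sf[A [oA Ax /(_ k)]]; exists A.
elim: k f => [|k IH] f sf.
  by move=> x Ux; have [A [_ Ax /(_ x Ax)]] := sf _ Ux.
split=> [y Uy|v]; first by have [A [_ Ay [/(_ y Ay)]]] := sf _ Uy.
by apply: IH => y /sf[A [oA Ay [_ /(_ v)]]]; exists A.
Qed.

Lemma smooth_at_near V W (f : V -> W) (x : V) :
  smooth_at f x -> \near x, smooth_at f x.
Proof.
move=> [U [oU Ux sf]]; have : \near x, U x by exact: open_nbhs_nbhs.
by apply: filterS; apply/smooth_onP.
Qed.

Lemma smooth_at_eq V W (f g : V -> W) (x : V) :
  (\near x, f x = g x) -> smooth_at f x -> smooth_at g x.
Proof.
move=> nfg [U [oU Ux sf]]; move: nfg; rewrite -nbhs_nearE nbhsE => -[B [oB Bx] fg].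
exists (B `&` U); split => //; first exact: openI.
move=> k; apply: (@Ck_on_eq _ k _ _ _ f); first exact: openI.
  by move=> y [/fg].
by apply: Ck_on_sub (sf k) => y [].
Qed.

Lemma smooth_at_differentiable V W (f : V -> W) (x : V) :
  smooth_at f x -> differentiable f x.
Proof. by move=> [U [_ Ux /(_ 1%N)[/(_ _ Ux)]]]. Qed.

Lemma smooth_at_continuous V W (f : V -> W) (x : V) :
  smooth_at f x -> {for x, continuous f}.
Proof. by move=> /smooth_at_differentiable /differentiable_continuous. Qed.

Lemma smooth_at_derive V W (f : V -> W) (x v : V) :
  smooth_at f x -> smooth_at (fun x => 'D_v f x) x.
Proof.
by move=> [U [oU Ux sf]]; exists U; split=> // k; have [_] := sf k.+1; apply.
Qed.

Lemma smooth_at_cst V W (a : W) (x : V) : smooth_at (fun=> a) x.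
Proof. by exists setT; split=> // [|k]; [exact: openT | exact: Ck_on_cst]. Qed.

Lemma smooth_at_linear V W (f : V -> W) (x : V) :
  findim V -> linear f -> smooth_at f x.
Proof.
move=> fV lf; have cf := findim_linear_continuous fV lf.
have [g fg] := linear_packed lf; rewrite fg in cf *.
by exists setT; split=> // [|k]; [exact: openT | exact: Ck_on_linear].
Qed.

Lemma smooth_at_id V (x : V) : smooth_at id x.
Proof.
exists setT; split=> // [|k]; first exact: openT.
by apply: (@Ck_on_linear _ k V V setT idfun) => y; exact: cvg_id.
Qed.

Lemma smooth_at2 V W W' Z (F : (V -> W) -> (V -> W') -> V -> Z) (x : V) f g :
  (forall k U, open U -> Ck_on k U f -> Ck_on k U g -> Ck_on k U (F f g)) ->
  smooth_at f x -> smooth_at g x -> smooth_at (F f g) x.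
Proof.
move=> HF [U [oU Ux sf]] [U' [oU' U'x sg]]; exists (U `&` U'); split=> //.
  exact: openI.
move=> k; apply: HF; [exact: openI | apply: Ck_on_sub (sf k) | apply: Ck_on_sub (sg k)];
  by move=> y [].
Qed.

Lemma smooth_atD V W (f g : V -> W) (x : V) :
  smooth_at f x -> smooth_at g x -> smooth_at (fun x => f x + g x) x.
Proof.
by apply: (smooth_at2 (F := fun f g x => f x + g x)) => k U; exact: Ck_onD.
Qed.

Lemma smooth_atZ V W (f : V -> R) (g : V -> W) (x : V) :
  smooth_at (f : V -> R^o) x -> smooth_at g x ->
  smooth_at (fun x => f x *: g x) x.
Proof.
apply: (smooth_at2 (F := fun (f : V -> R^o) g x => f x *: g x)) => k U.
exact: Ck_onZ.
Qed.

Lemma smooth_atM V (f g : V -> R^o) (x : V) :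
  smooth_at f x -> smooth_at g x -> smooth_at (fun x => f x * g x : R^o) x.
Proof. exact: smooth_atZ. Qed.

Lemma smooth_at_comp V W Z (f : V -> W) (g : W -> Z) (x : V) :
  findim W -> smooth_at f x -> smooth_at g (f x) -> smooth_at (g \o f) x.
Proof.
move=> fW [U [oU Ux sf]] [U' [oU' U'x sg]].
have cf y : U y -> {for y, continuous f} by apply: (sf 0%N).
have oV : open (U `&` f @^-1` U').
  rewrite openE => y [Uy U'y]; rewrite /interior.
  apply: filterI; first exact: open_nbhs_nbhs.
  by apply: (cf y Uy); exact: open_nbhs_nbhs.
exists (U `&` f @^-1` U'); split=> // k.
apply: (Ck_on_comp (U' := U') fW) => //; first by move=> y [].
by apply: Ck_on_sub (sf k) => y [].
Qed.

Lemma smooth_at_sum V W I (r : seq I) (p : pred I) (f : I -> V -> W) (x : V) :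
  (forall i, p i -> smooth_at (f i) x) ->
  smooth_at (fun x => \sum_(i <- r | p i) f i x) x.
Proof.
move=> sf; elim: r => [|i r IH].
  by under eq_fun do rewrite big_nil; exact: smooth_at_cst.
under eq_fun do rewrite big_cons.
by case pi: (p i) => //; apply: smooth_atD => //; exact: sf.
Qed.

Lemma smooth_at_prod V I (r : seq I) (p : pred I) (f : I -> V -> R) (x : V) :
  (forall i, p i -> smooth_at (f i : V -> R^o) x) ->
  smooth_at (fun x => \prod_(i <- r | p i) f i x : R^o) x.
Proof.
move=> sf; elim: r => [|i r IH].
  by under eq_fun do rewrite big_nil; exact: smooth_at_cst.
under eq_fun do rewrite big_cons.
by case pi: (p i) => //; apply: smooth_atM => //; exact: sf.
Qed.

Lemma smooth_atV V (f : V -> R) (x : V) : f x != 0 ->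
  smooth_at (f : V -> R^o) x -> smooth_at (fun x => (f x)^-1 : R^o) x.
Proof.
move=> f0 [U [oU Ux sf]].
have cf y : U y -> {for y, continuous (f : V -> R^o)} by apply: (sf 0%N).
have oV : open (U `&` [set y | f y != 0]).
  rewrite openE => y [Uy fy0]; rewrite /interior.
  apply: filterI; first exact: open_nbhs_nbhs.
  apply: (cf y Uy (fun z => z != 0)).
  exact: open_nbhs_nbhs (conj (@open_neq R 0) fy0).
exists (U `&` [set y | f y != 0]); split=> // k.
apply: Ck_onV => //; first by move=> y [].
by apply: Ck_on_sub (sf k) => y [].
Qed.

Lemma smooth_at_pair V W Z (f : V -> W) (g : V -> Z) (x : V) :
  smooth_at f x -> smooth_at g x -> findim W -> findim Z ->
  smooth_at (fun x => (f x, g x)) x.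
Proof.
move=> sf sg fW fZ.
have s1 : smooth_at ((fun w => (w, 0 : Z)) \o f) x.
  apply: smooth_at_comp => //; apply: smooth_at_linear => // a u v.
  by apply: injective_projections; rewrite /= ?scaler0 ?add0r.
have s2 : smooth_at ((fun z => (0 : W, z)) \o g) x.
  apply: smooth_at_comp => //; apply: smooth_at_linear => // a u v.
  by apply: injective_projections; rewrite /= ?scaler0 ?add0r.
have := smooth_atD s1 s2; congr smooth_at; apply/funext => y /=.
by apply: injective_projections; rewrite /= ?addr0 ?add0r.
Qed.

Lemma smooth_at_lin V W Z (f : V -> W) (l : W -> Z) (x : V) :
  findim W -> linear l -> smooth_at f x -> smooth_at (fun x => l (f x)) x.
Proof.
by move=> fW ll sf; apply: (smooth_at_comp fW sf); exact: smooth_at_linear.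
Qed.

Lemma smooth_at_coord V m n (f : V -> 'M[R]_(m, n)) i j (x : V) :
  smooth_at f x -> smooth_at (fun x => f x i j : R^o) x.
Proof.
apply: (@smooth_at_lin _ _ R^o f (fun M => M i j)); first exact: findim_mx.
by move=> a A B; rewrite !mxE.
Qed.

Lemma smooth_at_mx V m n (f : V -> 'M[R]_(m, n)) (x : V) :
  (forall i j, smooth_at (fun x => f x i j : R^o) x) -> smooth_at f x.
Proof.
move=> sf.
have -> : f = fun x => \sum_(i < m) \sum_(j < n) f x i j *: delta_mx i j.
  by apply/funext => y; exact: matrix_sum_delta.
do 2![apply: smooth_at_sum => ? _].
by apply: smooth_atZ; [exact: sf | exact: smooth_at_cst].
Qed.

Lemma smooth_at_mulmx V m n p (f : V -> 'M[R]_(m, n)) (g : V -> 'M[R]_(n, p)) (x : V) :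
  smooth_at f x -> smooth_at g x -> smooth_at (fun x => f x *m g x) x.
Proof.
move=> sf sg; apply: smooth_at_mx => i j; under eq_fun do rewrite mxE.
apply: smooth_at_sum => l _.
by apply: smooth_atM; exact: smooth_at_coord.
Qed.

Lemma smooth_at_tr V m n (f : V -> 'M[R]_(m, n)) (x : V) :
  smooth_at f x -> smooth_at (fun x => (f x)^T) x.
Proof.
apply: (@smooth_at_lin _ _ _ f (fun M => M^T)); first exact: findim_mx.
by move=> a A B; rewrite linearP.
Qed.

Lemma smooth_at_det V n (f : V -> 'M[R]_n) (x : V) :
  smooth_at f x -> smooth_at (fun x => \det (f x) : R^o) x.
Proof.
move=> sf; apply: smooth_at_sum => s _; apply: smooth_atM.
  exact: smooth_at_cst.
by apply: smooth_at_prod => i _; exact: smooth_at_coord.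
Qed.

(** Cramer's rule: near a point where the determinant is nonzero, [invmx] is the adjugate divided by
    the determinant. Elsewhere it takes a default value, hence the restriction to a
    neighbourhood. *)
Lemma smooth_at_invmx V n (f : V -> 'M[R]_n) (x : V) :
  f x \in unitmx -> smooth_at f x -> smooth_at (fun x => invmx (f x)) x.
Proof.
move=> uf sf; have sd := smooth_at_det sf.
have d0 : \det (f x) != 0 by rewrite -unitfE -unitmxE.
have nd : \near x, \det (f x) != 0.
  exact: (smooth_at_continuous sd (open_nbhs_nbhs (conj (@open_neq R 0) d0))).
have nu : \near x, f x \in unitmx.
  by apply: filterS nd => y dy; rewrite unitmxE unitfE.
apply: (@smooth_at_eq _ _ (fun x => (\det (f x))^-1 *: \adj (f x))).
  by apply: filterS nu => y uy; rewrite /invmx uy.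
apply: smooth_atZ; first exact: smooth_atV.
apply: smooth_at_mx => i j; under eq_fun do rewrite mxE /cofactor.
apply: smooth_atM; first exact: smooth_at_cst.
apply: smooth_at_det; apply: smooth_at_mx => i' j'.
by under eq_fun do rewrite !mxE; exact: smooth_at_coord.
Qed.

(** If v K K^T = 0 then the sum of the squares of the entries of v K vanishes, so v K = 0 and v = 0.
    This yields one-sided inverses of rectangular matrices that depend smoothly on the entries. *)
Lemma gram_unitmx m n (K : 'M[R]_(m, n)) : row_free K -> K *m K^T \in unitmx.
Proof.
move=> rK; rewrite -row_free_unit -kermx_eq0; apply/eqP/row_matrixP => i.
rewrite row0; set v := row i _.
have vK : v *m (K *m K^T) = 0.
  by rewrite /v -row_mul mulmx_ker row0.
have : (v *m K) *m (v *m K)^T = 0 by rewrite trmx_mul !mulmxA -(mulmxA v) vK mul0mx.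
move=> /matrixP/(_ 0 0); rewrite !mxE => /eqP.
rewrite psumr_eq0 => [/allP vK0|j _]; last by rewrite [X in _ * X]mxE -expr2 sqr_ge0.
have {vK0} : v *m K = 0.
  apply/rowP => j; have := vK0 j (mem_index_enum _).
  by rewrite /= [X in _ * X]mxE mulf_eq0 orbb => /eqP ->; rewrite mxE.
by move=> /eqP; rewrite mulmx_free_eq0 // => /eqP.
Qed.

(** Both the base point and the vector vary; expanding the vector in coordinates leaves only
    derivatives along constant directions. *)
Lemma smooth_at_diff V W Z (f : W -> Z) (y : V -> W) (v : V -> W) (x : V) :
  findim W -> smooth_at y x -> smooth_at v x -> smooth_at f (y x) ->
  smooth_at (fun x => 'd f (y x) (v x)) x.
Proof.
move=> fW sy sv sf; have [I [e [l [cl el]]]] := fW.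
have nf : \near x, smooth_at f (y x).
  exact: (smooth_at_continuous sy (smooth_at_near sf)).
apply: (@smooth_at_eq _ _ (fun x => \sum_i l i (v x) *: 'D_(e i) f (y x))).
  apply: filterS nf => z sz; rewrite [in RHS](el (v z)) linear_sum.
  apply: eq_bigr => i _; rewrite linearZ deriveE //.
  exact: smooth_at_differentiable.
apply: smooth_at_sum => i _; apply: smooth_atZ.
  by apply: (@smooth_at_lin _ _ R^o v (l i)) => // a b c; rewrite linearP.
exact: (smooth_at_comp fW sy (smooth_at_derive (e i) sf)).
Qed.

End SmoothAt.

(** * Functions and tangent maps on manifolds *)

Section ManifoldCalculus.
Context {R : realType}.
Implicit Types U V W : normedModType R.

(** Chain rule in the form charts require: inserting a chart and its inverse recovers the function
    only near the point, and the base point [y] equals [G x] only after a chart has been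
    cancelled. *)
Lemma diff_comp_near U V W (G : U -> V) (F : V -> W) (H : U -> W) (x : U) (y : V) v :
  differentiable G x -> differentiable F y -> G x = y ->
  (\forall z \near x, F (G z) = H z) -> 'd H x v = 'd F y ('d G x v).
Proof.
move=> dG dF Gx FG; move: dF; rewrite -{}Gx => dF; have dFG := differentiable_comp dG dF.
by rewrite -(@near_eq_diff _ _ _ (F \o G) H x FG dFG) diff_comp.
Qed.

Lemma chart_at_atlas n (M : manifold R n) (x : M) : atlas (chart_at x).
Proof. by rewrite /chart_at; case: cid2. Qed.

Lemma chart_at_dom n (M : manifold R n) (x : M) : cdom (chart_at x) x.
Proof. by rewrite /chart_at; case: cid2. Qed.

Lemma chart_img_open n (M : topologicalType) (c : chart R M n) (U : set M) :
  open U -> open (c @` (cdom c `&` U)).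
Proof.
move=> oU; have -> : c @` (cdom c `&` U) = (c @` cdom c) `&` (cinv c @^-1` U).
  apply/seteqP; split=> [_ [x [cx Ux] <-]|_ [[x cx <-] Ux]] /=.
    by split; [exists x | rewrite cmapK].
  by move: Ux; rewrite /= cmapK // => Ux; exists x.
rewrite openE => _ [[x cx <-] Ux]; move: Ux; rewrite /= cmapK // => Ux; rewrite /interior.
apply: filterI; first by apply: open_nbhs_nbhs; split; [exact: cimg_open | exists x].
apply: (cinv_continuous cx); rewrite cmapK //; exact: open_nbhs_nbhs.
Qed.

Lemma near_cdom n (M : topologicalType) (c : chart R M n) (x : M) :
  cdom c x -> \near x, cdom c x.
Proof. by move=> cx; apply: open_nbhs_nbhs; split=> //; exact: cdom_open. Qed.

Lemma near_cimg n (M : topologicalType) (c : chart R M n) (x : M) :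
  cdom c x -> \forall y \near c x, cdom c (cinv c y) /\ c (cinv c y) = y.
Proof.
move=> cx; have : \forall y \near c x, (c @` cdom c) y.
  by apply: open_nbhs_nbhs; split; [exact: cimg_open | exists x].
by apply: filterS => _ [y cy <-]; rewrite !cmapK.
Qed.

Lemma near_cinv n (M : topologicalType) (c : chart R M n) (x : M) (P : M -> Prop) :
  cdom c x -> (\near x, P x) -> \forall y \near c x, P (cinv c y).
Proof. by move=> cx Px; apply: (cinv_continuous cx); rewrite cmapK. Qed.

Lemma near_chart n (M : topologicalType) (c : chart R M n) (x : M)
    (P : 'rV[R]_n -> Prop) :
  cdom c x -> (\forall y \near c x, P y) -> \near x, P (c x).
Proof. by move=> cx Px; exact: (cmap_continuous cx). Qed.

Lemma transition_smooth n (M : manifold R n) (c c' : chart R M n) (x : M) :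
  atlas c -> atlas c' -> cdom c x -> cdom c' x -> smooth_at (c' \o cinv c) (c x).
Proof.
move=> ac ac' cx c'x; exists (c @` (cdom c `&` cdom c')); split.
- by apply: chart_img_open; exact: cdom_open.
- by exists x.
- exact: atlas_compat.
Qed.

Definition msmooth_at n (M : manifold R n) V (f : M -> V) (x : M) : Prop :=
  smooth_at (f \o cinv (chart_at x)) (chart_at x x).

Lemma smooth_at_rechart n (M : manifold R n) V (f : M -> V) (c c' : chart R M n)
    (x : M) :
  atlas c -> atlas c' -> cdom c x -> cdom c' x ->
  smooth_at (f \o cinv c) (c x) -> smooth_at (f \o cinv c') (c' x).
Proof.
move=> ac ac' cx c'x sf.
apply: (@smooth_at_eq _ _ _ ((f \o cinv c) \o (c \o cinv c'))).
  have := near_cinv c'x (near_cdom cx).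
  by apply: filterS => y cy /=; rewrite cmapK.
apply: smooth_at_comp; [exact: findim_mx | exact: transition_smooth |].
by rewrite /= cmapK.
Qed.

Lemma msmooth_atP n (M : manifold R n) V (f : M -> V) (c : chart R M n) (x : M) :
  atlas c -> cdom c x -> msmooth_at f x <-> smooth_at (f \o cinv c) (c x).
Proof.
have ax := chart_at_atlas x; have dx := chart_at_dom x.
by move=> ac cx; split; exact: smooth_at_rechart.
Qed.

Lemma smooth_fun_onP n (M : manifold R n) V (U : set M) (f : M -> V) :
  open U -> smooth_fun_on U f <-> forall x, U x -> msmooth_at f x.
Proof.
move=> oU; split=> [sf x Ux|sf c ac].
  have ax := chart_at_atlas x; have dx := chart_at_dom x.
  have /smooth_onP : open ((chart_at x) @` (cdom (chart_at x) `&` U)).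
    exact: chart_img_open.
  by move=> /(_ _ (f \o cinv (chart_at x)))[+ _]; apply; [exact: sf | exists x].
apply/smooth_onP; first exact: chart_img_open.
by move=> _ [x [cx Ux] <-]; apply/msmooth_atP => //; exact: sf.
Qed.

Lemma smooth_funP n (M : manifold R n) V (f : M -> V) :
  smooth_fun f <-> forall x, msmooth_at f x.
Proof.
split=> [/smooth_fun_onP sf x|sf]; first by apply: sf => //; exact: openT.
by apply/smooth_fun_onP => //; exact: openT.
Qed.

Lemma msmooth_at_eq n (M : manifold R n) V (f g : M -> V) (x : M) :
  (\near x, f x = g x) -> msmooth_at f x -> msmooth_at g x.
Proof. by move=> fg; apply: smooth_at_eq; exact: near_cinv (chart_at_dom x) fg. Qed.

Lemma msmooth_at_near n (M : manifold R n) V (f : M -> V) (x : M) :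
  msmooth_at f x -> \near x, msmooth_at f x.
Proof.
move=> /smooth_at_near sf; have dx := chart_at_dom x.
have ax := chart_at_atlas x.
apply: filterS2 (near_chart dx sf) (near_cdom dx) => y sy cy.
exact/(msmooth_atP _ ax).
Qed.

Lemma msmooth_at_continuous n (M : manifold R n) V (f : M -> V) (x : M) :
  msmooth_at f x -> {for x, continuous f}.
Proof.
move=> /smooth_at_continuous sf; have dx := chart_at_dom x.
move=> A; rewrite -[f x]/((f \o id) x) -{1}(cmapK dx) => Af.
have := near_chart dx (sf _ Af); rewrite -nbhs_nearE => H.
apply: filterS2 H (near_cdom dx) => y /=.
by move=> + cy; rewrite cmapK.
Qed.

(** Continuity keeps nearby values inside the domain of [chart_at (g x)], outside of which the chart
    is an arbitrary function. *)
Definition msmooth_map_at n n' (M : manifold R n) (M' : manifold R n')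
    (g : M -> M') (x : M) : Prop :=
  {for x, continuous g} /\ msmooth_at (chart_at (g x) \o g) x.

Lemma smooth_map_at n n' (M : manifold R n) (M' : manifold R n') (g : M -> M')
    (x : M) : smooth_map g -> msmooth_map_at g x.
Proof.
move=> [cg sg]; split; first exact: cg.
have := sg _ _ (chart_at_atlas x) (chart_at_atlas (g x)) => sgx.
exists ((chart_at x) @` (cdom (chart_at x) `&` g @^-1` (cdom (chart_at (g x))))); split=> //.
  apply: chart_img_open; apply: open_comp => [y _|]; [exact: cg | exact: cdom_open].
by exists x => //; split; exact: chart_at_dom.
Qed.

Section Composition.
Context n n' (M : manifold R n) (M' : manifold R n') (g : M -> M') (x : M).
Hypothesis sg : msmooth_map_at g x.

Let comp_eq V (f : M' -> V) :
  \forall y \near chart_at x x,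
    ((f \o cinv (chart_at (g x))) \o ((chart_at (g x) \o g) \o cinv (chart_at x))) y
    = ((f \o g) \o cinv (chart_at x)) y.
Proof.
have cgx : \forall y \near x, cdom (chart_at (g x)) (g y).
  exact: (sg.1 _ (near_cdom (chart_at_dom (g x)))).
have := near_cinv (chart_at_dom x) cgx.
by apply: filterS => y cy /=; rewrite cmapK.
Qed.

Lemma msmooth_at_comp V (f : M' -> V) :
  msmooth_at f (g x) -> msmooth_at (f \o g) x.
Proof.
move=> sf; apply: smooth_at_eq (comp_eq f) _.
apply: smooth_at_comp; [exact: findim_mx | exact: sg.2 |].
by rewrite /= cmapK //; exact: chart_at_dom.
Qed.

Lemma dfun_comp V (f : M' -> V) (v : 'rV[R]_n) : msmooth_at f (g x) ->
  dfun (f \o g) x v = dfun f (g x) (tmap g x v).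
Proof.
move=> sf; have dg := smooth_at_differentiable sg.2.
have df := smooth_at_differentiable sf.
have gx : ((chart_at (g x) \o g) \o cinv (chart_at x)) (chart_at x x)
          = chart_at (g x) (g x).
  by rewrite /= cmapK //; exact: chart_at_dom.
exact: (diff_comp_near _ dg df gx (comp_eq f)).
Qed.

Lemma msmooth_at_chart (c : chart R M' n') :
  atlas c -> cdom c (g x) -> msmooth_at (c \o g) x.
Proof.
move=> ac cgx; apply: msmooth_at_comp; apply/(msmooth_atP _ ac cgx).
apply: (@smooth_at_eq _ _ _ id); last exact: smooth_at_id.
by have := near_cimg cgx; apply: filterS => y [].
Qed.

End Composition.

Lemma tmap_comp n n' n'' (M : manifold R n) (M' : manifold R n')
    (M'' : manifold R n'') (g : M -> M') (h : M' -> M'') (x : M) (v : 'rV[R]_n) :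
  msmooth_map_at g x -> msmooth_map_at h (g x) ->
  tmap (h \o g) x v = tmap h (g x) (tmap g x v).
Proof. by move=> sg sh; rewrite -[tmap h _ _]dfun_comp //; exact: sh.2. Qed.

Section Differential.
Context n (M : manifold R n).
Implicit Types (x : M) (v w e : 'rV[R]_n) (c : chart R M n).

Lemma msmooth_at_cmap c x : atlas c -> cdom c x -> msmooth_at c x.
Proof.
move=> ac cx; apply/(msmooth_atP _ ac cx).
apply: (@smooth_at_eq _ _ _ id); last exact: smooth_at_id.
by have := near_cimg cx; apply: filterS => y [].
Qed.

Lemma dfun_linear V (f : M -> V) x : linear (dfun f x).
Proof. by move=> a u v; rewrite /dfun linearP. Qed.

Lemma dfun0 V (f : M -> V) x : dfun f x 0 = 0.
Proof. by rewrite /dfun linear0. Qed.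

Lemma dfun_near V (f g : M -> V) x v :
  (\near x, f x = g x) -> msmooth_at f x -> dfun f x v = dfun g x v.
Proof.
move=> fg /smooth_at_differentiable df; rewrite /dfun.
rewrite (@near_eq_diff _ _ _ _ (g \o cinv (chart_at x))) //.
exact: near_cinv (chart_at_dom x) fg.
Qed.

Lemma dfunE c V (f : M -> V) x v : atlas c -> cdom c x -> msmooth_at f x ->
  dfun f x v = 'd (f \o cinv c) (c x) (dfun c x v).
Proof.
move=> ac cx sf; have dx := chart_at_dom x.
have /smooth_at_differentiable df := (msmooth_atP f ac cx).1 sf.
have /smooth_at_differentiable dc := transition_smooth (chart_at_atlas x) ac dx cx.
have cE : (c \o cinv (chart_at x)) (chart_at x x) = c x by rewrite /= cmapK.
have nE : \forall y \near chart_at x x,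
    ((f \o cinv c) \o (c \o cinv (chart_at x))) y = (f \o cinv (chart_at x)) y.
  have := near_cinv dx (near_cdom cx).
  by apply: filterS => y cy /=; rewrite cmapK.
exact: (diff_comp_near _ dc df cE nE).
Qed.

Lemma dfun_coord_vec c V (f : M -> V) x e : atlas c -> cdom c x -> msmooth_at f x ->
  dfun f x (coord_vec c x e) = 'd (f \o cinv c) (c x) e.
Proof.
move=> ac cx sf; have dx := chart_at_dom x.
have /smooth_at_differentiable df := sf.
have /smooth_at_differentiable dc := transition_smooth ac (chart_at_atlas x) cx dx.
have cE : (chart_at x \o cinv c) (c x) = chart_at x x by rewrite /= cmapK.
have nE : \forall y \near c x,
    ((f \o cinv (chart_at x)) \o (chart_at x \o cinv c)) y = (f \o cinv c) y.
  have := near_cinv cx (near_cdom dx).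
  by apply: filterS => y cy /=; rewrite cmapK.
exact/esym/(diff_comp_near _ dc df cE nE).
Qed.

Lemma coord_vecK c x e : atlas c -> cdom c x -> dfun c x (coord_vec c x e) = e.
Proof.
move=> ac cx; rewrite (dfun_coord_vec _ ac cx); last exact: msmooth_at_cmap.
rewrite -(@near_eq_diff _ _ _ id); last first.
- exact: smooth_at_differentiable (smooth_at_id _).
- by have := near_cimg cx; apply: filterS => y [_ /= ->].
by rewrite diff_val.
Qed.

Lemma dfun_chart_at x v : dfun (chart_at x) x v = v.
Proof.
rewrite /dfun -(@near_eq_diff _ _ _ id); last first.
- exact: smooth_at_differentiable (smooth_at_id _).
- by have := near_cimg (chart_at_dom x); apply: filterS => y [_ /= ->].
by rewrite diff_val.
Qed.

Lemma dfunK c x v : atlas c -> cdom c x -> coord_vec c x (dfun c x v) = v.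
Proof.
move=> ac cx; rewrite /coord_vec -dfunE ?dfun_chart_at //.
exact: msmooth_at_cmap (chart_at_atlas x) (chart_at_dom x).
Qed.

Lemma coord_vec_linear c x : linear (coord_vec c x).
Proof. by move=> a u v; rewrite /coord_vec linearP. Qed.

(** The coordinates [Z y] refer to the chart [chart_at y], which may jump with y. Smoothness of Z
    therefore makes sense only for [dfun c y (Z y)], its components in the fixed chart c. *)
Lemma msmooth_at_dfun c V (f : M -> V) (Z : M -> 'rV[R]_n) x :
  atlas c -> cdom c x -> msmooth_at (fun y => dfun c y (Z y)) x ->
  msmooth_at f x -> msmooth_at (fun y => dfun f y (Z y)) x.
Proof.
move=> ac cx sZ sf.
apply: (@msmooth_at_eq _ _ _ (fun y => 'd (f \o cinv c) (c y) (dfun c y (Z y)))).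
  apply: filterS2 (near_cdom cx) (msmooth_at_near sf) => y cy sy.
  by rewrite -dfunE.
apply/(msmooth_atP _ ac cx).
apply: (@smooth_at_eq _ _ _ (fun y => 'd (f \o cinv c) y (dfun c (cinv c y) (Z (cinv c y))))).
  by have := near_cimg cx; apply: filterS => y [_ /= ->].
apply: smooth_at_diff; first exact: findim_mx.
- exact: smooth_at_id.
- exact/(msmooth_atP (fun y => dfun c y (Z y)) ac cx).
- exact/(msmooth_atP f ac cx).
Qed.

(** [smooth_form] tests [w] on constant coordinate vectors, so Z is expanded in the coordinate frame
    of c. *)
Lemma msmooth_at_form c V (w : M -> 'rV[R]_n -> V) (Z : M -> 'rV[R]_n) x :
  atlas c -> cdom c x -> smooth_form w ->
  msmooth_at (fun y => dfun c y (Z y)) x -> msmooth_at (fun y => w y (Z y)) x.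
Proof.
move=> ac cx [lw sw] sZ.
apply: (@msmooth_at_eq _ _ _
  (fun y => \sum_i (dfun c y (Z y)) 0 i *: w y (coord_vec c y (delta_mx 0 i)))).
  apply: filterS (near_cdom cx) => y cy.
  rewrite -[in RHS](dfunK (Z y) ac cy) [in RHS](row_sum_delta (dfun c y (Z y))).
  have [g gE] := linear_packed (@coord_vec_linear c y).
  have [h hE] := linear_packed (lw y).
  by rewrite gE hE !linear_sum; apply: eq_bigr => i _; rewrite !linearZ.
apply: smooth_at_sum => i _; apply: smooth_atZ; first exact: smooth_at_coord.
have /smooth_fun_onP := sw c ac (delta_mx 0 i).
by apply=> //; exact: cdom_open.
Qed.

End Differential.
End ManifoldCalculus.

(** * The Lorentz algebra *)

Section LorentzAlgebra.
Context {R : realType} {m : nat}.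
Local Notation L := 'cV[R]_(1 + (m + 1)).
Local Notation Mat := 'M[R]_(1 + (m + 1)).
Implicit Types (v w : L) (M h : Mat).

Definition dotp (X Y : 'cV[R]_m) : R := (X^T *m Y) 0 0.

Lemma lcol_surj v : exists a X b, v = lcol a X b.
Proof.
exists (usubmx v 0 0), (usubmx (dsubmx v)), (dsubmx (dsubmx v) 0 0).
by rewrite /lcol -!mx11_scalar !vsubmxK.
Qed.

Lemma lcol_inj a X b a' (X' : 'cV[R]_m) b' :
  lcol a X b = lcol a' X' b' -> [/\ a = a', X = X' & b = b'].
Proof.
move=> /eq_col_mx[+ /eq_col_mx[XX']]; move=> /matrixP/(_ 0 0) + /matrixP/(_ 0 0).
by rewrite !mxE !mulr1n.
Qed.

Lemma lcolD a (X : 'cV[R]_m) b a' X' b' :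
  lcol a X b + lcol a' X' b' = lcol (a + a') (X + X') (b + b').
Proof. by rewrite /lcol !add_col_mx -!raddfD. Qed.

Lemma lcolZ k a (X : 'cV[R]_m) b : k *: lcol a X b = lcol (k * a) (k *: X) (k * b).
Proof. by rewrite /lcol !scale_col_mx !scale_scalar_mx. Qed.

Lemma lcol_mid_linear : linear (fun X : 'cV[R]_m => lcol 0 X 0).
Proof. by move=> a X Y; rewrite lcolZ lcolD mulr0 addr0. Qed.

Lemma lcol_mid_sum (X : 'cV[R]_m) :
  \sum_i X i 0 *: lcol 0 (delta_mx i 0) 0 = lcol 0 X 0.
Proof.
have [g gE] := linear_packed lcol_mid_linear.
rewrite [in RHS](matrix_sum_delta X) -[RHS]/((fun X : 'cV[R]_m => lcol 0 X 0) _) gE.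
rewrite linear_sum; apply: eq_bigr => i _.
by rewrite big_ord1 linearZ /= -gE.
Qed.

Lemma lcolE a (X : 'cV[R]_m) b : lcol a X b = a *: ell + lcol 0 X 0 + b *: nvec.
Proof. by rewrite /ell /nvec !lcolZ !lcolD !mulr1 !mulr0 !scaler0 !addr0 !add0r. Qed.

Lemma gram_lcol a (X : 'cV[R]_m) b : gram *m lcol a X b = lcol b X a.
Proof.
rewrite /gram /lcol mul_block_col mul_row_col !mul0mx !add0r mul1mx.
rewrite mul_col_mx mul0mx mul1mx mul_block_col !mul0mx !addr0 mul1mx.
by rewrite add_col_mx add0r addr0.
Qed.

Lemma lprodE a X b a' (X' : 'cV[R]_m) b' :
  lprod (lcol a X b) (lcol a' X' b') = a * b' + dotp X X' + b * a'.
Proof.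
rewrite /lprod -mulmxA gram_lcol /lcol !tr_col_mx !tr_scalar_mx !mul_row_col.
by rewrite -!scalar_mxM /dotp !mxE !mulr1n addrA.
Qed.

Lemma lprod_linearl w : linear (lprod ^~ w : L -> R^o).
Proof. by move=> a u v; rewrite /lprod linearP /= !mulmxDl -!scalemxAl !mxE. Qed.

Lemma gram_tr : (gram : Mat)^T = gram.
Proof.
by rewrite /gram tr_block_mx tr_row_mx tr_col_mx tr_block_mx !trmx0 !trmx1.
Qed.

Lemma lprodC v w : lprod v w = lprod w v.
Proof.
rewrite /lprod -[in RHS](trmxK (w^T *m gram *m v)) [in RHS]mxE.
by rewrite !trmx_mul trmxK gram_tr mulmxA.
Qed.

Lemma lprodDl u v w : lprod (u + v) w = lprod u w + lprod v w.
Proof. by have := lprod_linearl w 1 u v; rewrite !scale1r. Qed.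

Lemma lprodZl k v w : lprod (k *: v) w = k * lprod v w.
Proof. by rewrite /lprod linearZ /= -!scalemxAl mxE. Qed.

Lemma lprodDr u v w : lprod w (u + v) = lprod w u + lprod w v.
Proof. by rewrite lprodC lprodDl !(lprodC w). Qed.

Lemma lprodZr k v w : lprod v (k *: w) = k * lprod v w.
Proof. by rewrite lprodC lprodZl lprodC. Qed.

Lemma lprod_ell_lcol a (X : 'cV[R]_m) b : lprod ell (lcol a X b) = b.
Proof. by rewrite lprodE /dotp trmx0 mul0mx !mxE mul1r mul0r !addr0. Qed.

Lemma qformE a (X : 'cV[R]_m) a' X' :
  qform (a, X) (a', X') = lprod (lcol a X 0) (lcol a' X' 0).
Proof. by rewrite lprodE mulr0 mul0r add0r addr0. Qed.

Lemma gram_mul (p r t D : 'M[R]_1) (q C : 'rV[R]_m) (s B : 'cV[R]_m) (A : 'M[R]_m) :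
  (gram : Mat) *m block_mx p (row_mx q r) (col_mx s t) (block_mx A B C D)
  = block_mx t (row_mx C D) (col_mx s p) (block_mx A B q r).
Proof.
rewrite /gram mulmx_block !mul0mx !add0r mul_row_col mul0mx add0r mul1mx.
rewrite mul_row_block !mul0mx !add0r !mul1mx !mul_col_mx !mul0mx !mul1mx.
rewrite !mul_row_col !mul0mx !mul1mx !addr0.
by rewrite !add_col_mx !add0r !addr0 -block_mxEv.
Qed.

Lemma block_surj M : exists p q r s t A B C D,
  M = block_mx p (row_mx q r) (col_mx s t) (block_mx A B C D).
Proof.
exists (ulsubmx M), (lsubmx (ursubmx M)), (rsubmx (ursubmx M)).
exists (usubmx (dlsubmx M)), (dsubmx (dlsubmx M)).
exists (ulsubmx (drsubmx M)), (ursubmx (drsubmx M)).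
exists (dlsubmx (drsubmx M)), (drsubmx (drsubmx M)).
by rewrite hsubmxK vsubmxK !submxK.
Qed.

Lemma tr11 (A : 'M[R]_1) : A^T = A.
Proof. by apply/matrixP => i j; rewrite mxE !ord1. Qed.

Lemma skew11 (A : 'M[R]_1) : A = - A -> A = 0.
Proof.
move=> AE; apply/matrixP => i j; move/matrixP/(_ i j): AE; rewrite !mxE => AE.
by lra.
Qed.

(** Infinitesimal form of preserving the Lorentz metric. Comparing blocks of the skew matrix
    [gram *m M] recovers the shape [gmat], and the coordinate-free side is the one that
    differentiation of curves produces. *)
Lemma gLieP M : gLie R m M <-> (gram *m M)^T = - (gram *m M).
Proof.
split=> [[a [z [X [A [AT ->]]]]]|].
  rewrite /gmat -[col_mx X 0]/(col_mx X 0) gram_mul tr_block_mx opp_block_mx.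
  rewrite tr_row_mx tr_col_mx tr_block_mx opp_row_mx opp_col_mx opp_block_mx.
  by rewrite !linearN /= !trmxK !trmx0 !tr_scalar_mx AT !opprK !oppr0.
have [p [q [r [s [t [A [B [C [D ->]]]]]]]]] := block_surj M.
rewrite gram_mul tr_block_mx tr_row_mx tr_col_mx tr_block_mx.
rewrite opp_block_mx opp_row_mx opp_col_mx opp_block_mx.
move=> /eq_block_mx[+ /eq_row_mx[+ +] _ /eq_block_mx[+ + _ +]].
rewrite !tr11 => tE sC pD AT qB rE.
exists (p 0 0), q, s, A; split=> //; rewrite /gmat.
(* A 1 x 1 block is its own transpose, so skewness kills it; this accounts for the two zero corners
   of [gmat]. *)
have -> : t = 0 by exact: skew11.
have -> : r = 0 by exact: skew11.
have -> : C = - s^T by rewrite sC opprK.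
have -> : D = - p by rewrite pD opprK.
have -> : B = - q^T by rewrite qB opprK.
by rewrite -mx11_scalar.
Qed.

Lemma gLie_skew M v w : gLie R m M -> lprod (M *m v) w = - lprod v (M *m w).
Proof.
move=> /gLieP; rewrite trmx_mul gram_tr => Msk.
by rewrite /lprod trmx_mul -(mulmxA v^T M^T) Msk mulmxN mulNmx mxE !mulmxA.
Qed.

Lemma gmat_gLie a (X : 'cV[R]_m) : gLie R m (gmat a 0 X 0).
Proof. by exists a, 0, X, 0; rewrite trmx0 oppr0. Qed.

Lemma gh_proj_gmat a z (X : 'cV[R]_m) A : gh_proj (gmat a z X A) = (a, X).
Proof. by rewrite /gh_proj /gmat block_mxKul block_mxKdl col_mxKu mxE mulr1n. Qed.

(** Evaluation at [ell] is the projection to g/h in another guise; it translates [phi] into values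
    of the tractor derivative of [xi]. *)
Lemma gLie_ell M : gLie R m M ->
  M *m ell = lcol (gh_proj M).1 (gh_proj M).2 0.
Proof.
move=> [a [z [X [A [_ ->]]]]]; rewrite gh_proj_gmat /gmat /ell /lcol /=.
rewrite mul_block_col mul_row_col !mulmx0 mul0mx !addr0 mulmx1.
by rewrite raddf0 col_mx0 !mulmx0 !addr0 mulmx1.
Qed.

Lemma hLieP M : hLie R m M <-> gLie R m M /\ M *m ell = 0.
Proof.
split=> [[z [A [AT ->]]]|[gM]].
  have gM : gLie R m (gmat 0 z 0 A) by exists 0, z, 0, A.
  split=> //; rewrite gLie_ell // gh_proj_gmat /lcol /= raddf0.
  by rewrite !col_mx0.
move: (gM) => [a [z [X [A [AT ME]]]]].
rewrite gLie_ell // ME gh_proj_gmat /= => l0.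
have l00 : (0 : L) = lcol 0 0 0 by rewrite /lcol raddf0 !col_mx0.
rewrite l00 in l0.
by have [-> -> _] := lcol_inj l0; exists z, A.
Qed.

Lemma gram_gram : (gram : Mat) *m gram = 1%:M.
Proof.
by rewrite {2}/gram gram_mul -scalar_mx_block row_mx0 col_mx0 -scalar_mx_block.
Qed.

Lemma mx_form_inj (A B : Mat) :
  (forall v w : L, (v^T *m A *m w) 0 0 = (v^T *m B *m w) 0 0) -> A = B.
Proof.
move=> AB; apply/matrixP => i j; have := AB (delta_mx i 0) (delta_mx j 0).
by rewrite !trmx_delta -!rowE -!colE !mxE.
Qed.

Lemma Gset_gram h : Gset R m h -> h^T *m gram *m h = gram.
Proof.
move=> [hiso _]; apply: mx_form_inj => v w; have := hiso v w.
by rewrite /lprod trmx_mul !mulmxA.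
Qed.

Lemma Gset_unitmx h : Gset R m h -> h \in unitmx.
Proof.
move=> /Gset_gram hg; have /mulmx1_unit[] // : (gram *m h^T *m gram) *m h = 1%:M.
by rewrite -!mulmxA (mulmxA h^T) hg gram_gram.
Qed.

Lemma Hset_unitmx h : Hset R m h -> h \in unitmx.
Proof. by move=> [/Gset_unitmx]. Qed.

Lemma HsetM h h' : Hset R m h -> Hset R m h' -> Hset R m (h *m h').
Proof.
move=> [[hi hF] he] [[h'i h'F] h'e]; split; last by rewrite -mulmxA h'e he.
split=> [v w|]; first by rewrite -!mulmxA hi h'i.
rewrite -[in RHS]hF -[in RHS]h'F image_comp; apply: eq_imagel => v _ /=.
by rewrite mulmxA.
Qed.

Lemma HsetV h : Hset R m h -> Hset R m (invmx h).
Proof.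
move=> Hh; have uh := Hset_unitmx Hh; have [[hi hF] he] := Hh.
split; last by rewrite -[in LHS]he mulKmx.
split=> [v w|]; first by rewrite -hi !mulKVmx.
rewrite -[in LHS]hF image_comp -[RHS]image_id; apply: eq_imagel => v _ /=.
by rewrite mulKmx.
Qed.

Lemma lprod_invmx h v w : Hset R m h ->
  lprod (invmx h *m v) (invmx h *m w) = lprod v w.
Proof. by move=> /HsetV[[hi _] _]. Qed.

Lemma invmx_ell h : Hset R m h -> invmx h *m ell = ell.
Proof. by move=> /HsetV[]. Qed.

(** Both vectors have last coordinate 1. A common a with vanishing pairings forces X.Y = X.Y' for
    every X, hence equal middle parts, and nullity then determines the first coordinate. The
    coefficient a is left free because the kernel of a 1-form normalised on Z is a graph over the
    X-coordinates. *)
Lemma null_pairing_uniq (e e' : L) :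
  lprod e e = 0 -> lprod e' e' = 0 -> lprod ell e = 1 -> lprod ell e' = 1 ->
  (forall X, exists a, lprod (lcol a X 0) e = 0 /\ lprod (lcol a X 0) e' = 0) ->
  e = e'.
Proof.
have [a [Y [b ->]]] := lcol_surj e; have [a' [Y' [b' ->]]] := lcol_surj e'.
rewrite !lprod_ell_lcol => + + b1 b1'; rewrite {}b1 {}b1' !lprodE => n1 n2 HX.
have YY : Y = Y'.
  apply/colP => i; have [c] := HX (delta_mx i 0); rewrite !lprodE.
  by rewrite /dotp trmx_delta -!rowE !mxE => -[c1 c2]; lra.
by rewrite YY in n1 *; congr lcol; lra.
Qed.

End LorentzAlgebra.

(** * Vertical vectors and the tractor derivative *)

Section ProductMaps.
Context {R : realType}.
Implicit Types V W Z : normedModType R.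

Lemma differentiable_lin_comp V W Z (l : W -> Z) (f : V -> W) x :
  findim W -> linear l -> differentiable f x -> differentiable (fun x => l (f x)) x.
Proof.
move=> fW ll df; apply: (differentiable_comp df).
exact: smooth_at_differentiable (smooth_at_linear _ fW ll).
Qed.

Lemma diff_lin_comp V W Z (l : W -> Z) (f : V -> W) x v :
  findim W -> linear l -> differentiable f x ->
  'd (fun x => l (f x)) x v = l ('d f x v).
Proof.
move=> fW ll df; have cl := findim_linear_continuous fW ll.
have dl := smooth_at_differentiable (smooth_at_linear (f x) fW ll).
rewrite (diff_comp df dl) /=; have [L LE] := linear_packed ll.
by rewrite LE in cl *; rewrite diff_lin.
Qed.

Lemma diff_lin_comp_eq V W Z (l : W -> Z) (f : V -> W) x v A :
  findim W -> linear l -> differentiable f x -> 'd f x v = A ->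
  'd (fun x => l (f x)) x v = l A.
Proof. by move=> fW ll df <-; exact: diff_lin_comp. Qed.

Lemma diff_mulmx V m n p (f : V -> 'M[R]_(m, n)) (g : V -> 'M[R]_(n, p)) x v :
  differentiable f x -> differentiable g x ->
  'd (fun x => f x *m g x) x v = 'd f x v *m g x + f x *m 'd g x v.
Proof.
move=> df dg.
have bs : bilinear_for (GRing.Scale.Law.clone _ _ *:%R _)
    (GRing.Scale.Law.clone _ _ *:%R _) (@mulmx R m n p).
  by split=> [w|a] b y z /=; rewrite ?(mulmxDl, mulmxDr) -?(scalemxAl, scalemxAr).
pose sM := bilinear_isBilinear.Build R 'M[R]_(m, n) 'M[R]_(n, p) 'M[R]_(m, p) _ _
  (@mulmx R m n p) bs.
pose s : {bilinear 'M[R]_(m, n) -> 'M[R]_(n, p) -> 'M[R]_(m, p)} :=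
  HB.pack (@mulmx R m n p) sM.
have cs : continuous (fun p => s p.1 p.2).
  move=> z; apply: (@smooth_at_continuous _ _ _ (fun p => p.1 *m p.2)).
  have fp := findim_prod (@findim_mx R m n) (@findim_mx R n p).
  by apply: smooth_at_mulmx; apply: smooth_at_linear => // a b c.
have := diff_comp (differentiable_pair df dg) (differentiable_bilin _ cs).
rewrite diff_bilin // diff_pair // => /(congr1 (@^~ v)) /= ->.
by rewrite addrC.
Qed.

(* Rewriting with [diff_mulmx] makes unification unfold matrix products. *)
Lemma diff_mulmx_eq V m n p (f : V -> 'M[R]_(m, n)) (g : V -> 'M[R]_(n, p)) x v
    F G A B :
  differentiable f x -> differentiable g x -> f x = F -> g x = G ->
  'd f x v = A -> 'd g x v = B ->
  'd (fun x => f x *m g x) x v = A *m G + F *m B.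
Proof. by move=> df dg <- <- <- <-; exact: diff_mulmx. Qed.

Lemma near_slice (T U : topologicalType) (x : T) (h : U) (Q : T * U -> Prop) :
  (\forall z \near (x, h), Q z) -> \forall y \near x, Q (y, h).
Proof.
move=> [[A B] /= [nA nB] AB]; apply: filterS nA => y Ay.
by apply: AB; split=> //; exact: nbhs_singleton nB.
Qed.

(** [S] need not be open, so [f] cannot itself be differentiated in its second variable. This
    extracts a local smooth extension [G] on an open set, which does have a differential and agrees
    with [f] on U x S. *)
Lemma smooth_prod_onE n n' (M : manifold R n) V (M' : manifold R n') (U : set M)
    (S : set V) (f : M -> V -> M') (x : M) (h : V) (c : chart R M n)
    (c' : chart R M' n') :
  smooth_prod_on U S f -> U x -> S h -> atlas c -> atlas c' -> cdom c x ->
  cdom c' (f x h) ->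
  exists G : 'rV[R]_n * V -> 'rV[R]_n', smooth_at G (c x, h) /\
    \forall z \near (x, h), U z.1 -> S z.2 ->
      cdom c' (f z.1 z.2) /\ G (c z.1, z.2) = c' (f z.1 z.2).
Proof.
move=> sf Ux Sh ac ac' cx c'f.
have [F [A [B [[oA Ax] [oB Bh] FE Fc Fs]]]] := sf x h Ux Sh.
exists (fun z => c' (F (cinv c z.1) z.2)); split.
  set O := [set z : 'rV[R]_n * V | [/\ (c @` (cdom c `&` A)) z.1, B z.2 &
                          cdom c' (F (cinv c z.1) z.2)]].
  exists O; split; last exact: Fs.
  - rewrite openE => -[y k] [/= [x' [cx' Ax'] <-{y}] Bk]; rewrite cmapK // => c'F.
    have oc := @chart_img_open R n M c A oA.
    have n1 : \forall z \near (c x', k), (c @` (cdom c `&` A)) z.1.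
      by apply: cvg_fst; apply: open_nbhs_nbhs; split=> //; exists x'.
    have n2 : \forall z \near (c x', k), B z.2.
      by apply: cvg_snd; apply: open_nbhs_nbhs.
    have n3 : \forall z \near (c x', k), cdom c' (F (cinv c z.1) z.2).
      have := Fc x' k Ax' Bk _ (open_nbhs_nbhs (conj (cdom_open c') c'F)).
      move=> [[P Q] /= [nP nQ] PQ].
      have nP' := @near_cinv R n M c x' P cx' nP.
      by exists ([set y | P (cinv c y)], Q) => // z [Pz Qz]; exact: (PQ (cinv c z.1, z.2)).
    by near=> z; split; near: z.
  - by split=> /=; [exists x | | rewrite cmapK // FE].
near=> z => Uz Sz.
have -> : f z.1 z.2 = F z.1 z.2.
  by rewrite FE //; near: z; [apply: cvg_fst | apply: cvg_snd]; exact: open_nbhs_nbhs.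
rewrite /= cmapK; last by near: z; apply: cvg_fst; exact: near_cdom.
split=> //; near: z; rewrite -(FE x h) // in c'f.
exact: (Fc x h Ax Bh _ (open_nbhs_nbhs (conj (cdom_open c') c'f))).
Unshelve. all: by end_near. Qed.

(** With h fixed in S, the pairs (y, h) with y near x stay in U x S, where the smooth extension and
    [f] coincide. *)
Lemma smooth_prod_on_slice n n' (M : manifold R n) V (M' : manifold R n') (U : set M)
    (S : set V) (f : M -> V -> M') (x : M) (h : V) :
  smooth_prod_on U S f -> findim V -> open U -> U x -> S h ->
  msmooth_map_at (f^~ h) x.
Proof.
move=> sf fV oU Ux Sh.
have ac := chart_at_atlas x; have cx := chart_at_dom x.
have ac' := chart_at_atlas (f x h); have c'f := chart_at_dom (f x h).
have [G [sG /near_slice GE]] := smooth_prod_onE sf Ux Sh ac ac' cx c'f.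
have nU : \near x, U x by exact: open_nbhs_nbhs.
have E : \forall y \near x, cdom (chart_at (f x h)) (f y h) /\
    G (chart_at x y, h) = chart_at (f x h) (f y h).
  by apply: filterS2 GE nU => y /= H Uy; exact: H.
have sGh : smooth_at (fun y => G (y, h)) (chart_at x x).
  apply: (@smooth_at_comp _ _ _ _ (fun y => (y, h)) G) => //.
    by apply: findim_prod => //; exact: findim_mx.
  by apply: smooth_at_pair => //; [exact: smooth_at_id | exact: smooth_at_cst | exact: findim_mx].
have sg : msmooth_at (chart_at (f x h) \o f^~ h) x.
  apply: (@msmooth_at_eq _ _ _ _ (fun y => G (chart_at x y, h))).
    by apply: filterS E => y [].
  apply: smooth_at_eq sGh; have := near_cimg cx.
  by apply: filterS => y [_ /= ->].
(* Continuity is recovered from the chart expression, since the values near x remain in the domain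
   of the chart at [f x h]. *)
split=> // A Af.
have cA : \forall y \near chart_at (f x h) (f x h), A (cinv (chart_at (f x h)) y).
  by apply: near_cinv.
have H : \forall y \near x, A (cinv (chart_at (f x h)) (chart_at (f x h) (f y h))).
  exact: (msmooth_at_continuous sg cA).
by apply: filterS2 H E => y /= + [cy _]; rewrite cmapK.
Qed.

End ProductMaps.

(** * Curves in H and their velocities *)

Section Curves.
Context {R : realType}.

Lemma near_cvg (T U : topologicalType) (f : T -> U) (x : T) (y : U) (Q : U -> Prop) :
  f z @[z --> x] --> y -> (\forall w \near y, Q w) -> \forall t \near x, Q (f t).
Proof. by move=> fy Qy; exact: fy. Qed.

Lemma diff_sin (x v : R) : 'd (sin : R^o -> R^o) x v = v * cos x.
Proof.
have ds : differentiable (sin : R^o -> R^o) x by apply/derivable1_diffP; exact: derivable_sin.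
by rewrite deriv1E /= ?derive1E ?derive_val //; exact: derivable_sin.
Qed.

Lemma diff_cos (x v : R) : 'd (cos : R^o -> R^o) x v = - (v * sin x).
Proof.
by rewrite deriv1E /= ?derive1E ?derive_val /= ?scalerN //; exact: derivable_cos.
Qed.

Lemma smooth_at_sin (x : R^o) : smooth_at (sin : R^o -> R^o) x.
Proof.
have ds (y : R) : differentiable (sin : R^o -> R^o) y.
  by apply/derivable1_diffP; exact: derivable_sin.
have dc (y : R) : differentiable (cos : R^o -> R^o) y.
  by apply/derivable1_diffP; exact: derivable_cos.
exists setT; split=> // [|k]; first exact: openT.
(* Differentiation exchanges sine and cosine up to sign, so the induction on the order treats them
   together. *)
suff [] : Ck_on k setT (sin : R^o -> R^o) /\ Ck_on k setT (cos : R^o -> R^o) by [].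
elim: k => [|k [IHs IHc]].
  by split=> y _; exact: differentiable_continuous.
split; split=> // v.
- have := @Ck_onM _ k R^o setT (cst v) cos openT (@Ck_on_cst _ k R^o R^o setT v) IHc.
  by apply: Ck_on_eq => [|y _]; [exact: openT | rewrite deriveE // diff_sin].
- have := @Ck_onM _ k R^o setT (cst (- v)) sin openT (@Ck_on_cst _ k R^o R^o setT (- v)) IHs.
  by apply: Ck_on_eq => [|y _]; [exact: openT | rewrite deriveE // diff_cos mulNr].
Qed.

Lemma diff_sin_line (V : normedModType R) (p w : V) :
  'd (fun t : R^o => p + sin t *: w) 0 1 = w.
Proof.
have ds := smooth_at_differentiable (smooth_at_sin (0 : R^o)).
have dz := differentiableZl w ds.
have dp := differentiable_cst p (0 : R^o).
rewrite (diffD dp dz) /= (diff_cst p) (diffZl w ds) /= diff_sin.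
by rewrite cos0 mulr1 scale1r add0r.
Qed.

(** Differentiating c^T gram c = gram and c ell = ell at 0 gives the two conditions that
    characterise the isotropy algebra in [hLieP]. *)
Lemma diff_curve_hLie m (c : R -> 'M[R]_(1 + (m + 1))) :
  differentiable (c : R^o -> _) 0 -> (forall t, Hset R m (c t)) -> c 0 = 1%:M ->
  hLie R m ('d (c : R^o -> _) 0 1).
Proof.
move=> dc Hc c0; have [X XE] : exists X, 'd (c : R^o -> _) 0 1 = X by eexists.
rewrite XE.
have fM p q := @findim_mx R p q.
have lT : linear (fun M : 'M[R]_(1 + (m + 1)) => M^T) by move=> a A B; rewrite linearP.
have lg : linear (fun M : 'M[R]_(1 + (m + 1)) => gram *m M) by move=> a A B; rewrite linearP.
have le : linear (fun M : 'M[R]_(1 + (m + 1)) => M *m ell).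
  by move=> a A B; rewrite mulmxDl scalemxAl.
have dT := differentiable_lin_comp (fM _ _) lT dc.
have dg := differentiable_lin_comp (fM _ _) lg dc.
have dcst p (A : 'M[R]_(1 + (m + 1), p)) (f : R -> 'M[R]_(1 + (m + 1), p)) :
    (forall t, f t = A) -> 'd (f : R^o -> _) 0 1 = 0.
  by move=> fA; have -> : f = cst A by [apply/funext]; rewrite (diff_cst A).
apply/hLieP; split.
  apply/gLieP; rewrite trmx_mul gram_tr; apply/eqP; rewrite -addr_eq0; apply/eqP.
  have c0T : (c 0)^T = 1%:M by rewrite c0 trmx1.
  have c0g : gram *m c 0 = gram by rewrite c0 mulmx1.
  have E := diff_mulmx_eq dT dg c0T c0g (diff_lin_comp_eq (fM _ _) lT dc XE)
    (diff_lin_comp_eq (fM _ _) lg dc XE).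
  rewrite -[gram *m X]mul1mx; apply: etrans (esym E) _.
  by apply: (dcst _ gram) => t; rewrite mulmxA; apply: Gset_gram; have [] := Hc t.
apply: etrans (esym (diff_lin_comp_eq (fM _ _) le dc XE)) _.
by apply: (dcst _ ell) => t; have [] := Hc t.
Qed.

End Curves.

(** * Vertical vectors as velocities of orbits *)

Section Vertical.
Context {R : realType} {m k : nat} {N : manifold R m.+1} {P : principal_Hbundle k N}.
Local Notation Mat := 'M[R]_(1 + (m + 1)).
Local Notation prj := (@Defs.proj _ _ _ _ P).

Variables (U : set N) (g : P -> Mat) (Psi : N -> Mat -> P).
Hypothesis oU : open U.
Hypothesis sg : smooth_fun_on (prj @^-1` U) g.
Hypothesis sPsi : smooth_prod_on U (Hset R m) Psi.
Hypothesis gP : forall u : P, U (prj u) ->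
  [/\ Hset R m (g u), Psi (prj u) (g u) = u &
      forall h, Hset R m h -> g (act u h) = g u *m h].

Lemma proj_smooth_at (u : P) : msmooth_map_at prj u.
Proof. exact: smooth_map_at (proj_smooth P). Qed.

Lemma open_proj_preimage : open (prj @^-1` U).
Proof.
by apply: open_comp => // u _; have [cp _] := proj_smooth P; exact: cp.
Qed.

(* The curve in H is the group coordinate [g] along a coordinate line of P with
   direction z; running through the line as [sin t] keeps it in the chart for
   all t, and scaling z by eps > 0 makes the segment short enough. *)
Lemma vertical_fundamental (u : P) (z : 'rV[R]_k) :
  U (prj u) -> tmap prj u z = 0 ->
  exists eps : R, [/\ eps != 0, hLie R m (invmx (g u) *m dfun g u (eps *: z)) &
    is_fundamental u (invmx (g u) *m dfun g u (eps *: z)) (eps *: z)].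
Proof.
move=> Uu z0; set C := chart_at u.
have aC : atlas C := chart_at_atlas u; have uC : cdom C u := chart_at_dom u.
set O := C @` (cdom C `&` prj @^-1` U).
have oO : open O by apply: chart_img_open; exact: open_proj_preimage.
have OCu : O (C u) by exists u.
have [r /= r0 rO] := (nbhs_ballP _ _).1 (open_nbhs_nbhs (conj oO OCu)).
have z1 : 0 < `|z| + 1 by rewrite ltr_wpDl.
(* The displacement [sin t *: (eps *: z)] has norm at most r |z| / (|z| + 1) < r; the added 1 covers
   z = 0. *)
have [eps epsE] : exists e, e = r / (`|z| + 1) by eexists.
exists eps; have eps0 : 0 < eps by rewrite epsE divr_gt0.
pose line (t : R^o) : 'rV[R]_k := C u + sin t *: (eps *: z).
have lineO t : O (line t).
  apply: rO; rewrite -ball_normE /= opprD addNKr normrN !normrZ (gtr0_norm eps0).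
  apply: (@le_lt_trans _ _ (1 * (eps * `|z|))).
    by apply: ler_wpM2r; [rewrite mulr_ge0 // ltW | rewrite ler_norml sin_geN1 sin_le1].
  by rewrite mul1r epsE -mulrA gtr_pMr // mulrC ltr_pdivrMr // mul1r ltrDl.
have OE y : O y -> [/\ cdom C (cinv C y), C (cinv C y) = y & U (prj (cinv C y))].
  by move=> [u' [Cu' Uu'] <-]; rewrite !cmapK.
pose gam t := cinv C (line t).
have line0 : line 0 = C u by rewrite /line sin0 scale0r addr0.
have gam0 : gam 0 = u by rewrite /gam line0 cmapK.
have sline t : smooth_at line t.
  apply: smooth_atD; first exact: smooth_at_cst.
  by apply: smooth_atZ; [exact: smooth_at_sin | exact: smooth_at_cst].
have dline : 'd line 0 1 = eps *: z by exact: diff_sin_line.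
have sgO y : O y -> smooth_at (g \o cinv C) y.
  by apply: (smooth_onP _ oO).1; exact: sg.
have sgg t : smooth_at (fun t => g (gam t)) t.
  exact: (smooth_at_comp (@findim_mx R 1 k) (sline t) (sgO _ (lineO t))).
set gu := g u; have [Hgu Psiu gact] := gP Uu.
have ugu : gu \in unitmx by exact: Hset_unitmx Hgu.
(* Left multiplication by g(u)^-1 makes the curve start at the identity, and equivariance then gives
   [act u (c t)] the group coordinate [g (gam t)]. *)
pose c (t : R) := invmx gu *m g (gam t).
have sc t : smooth_at (c : R^o -> _) t.
  by apply: smooth_at_mulmx; [exact: smooth_at_cst | exact: sgg].
have dsc := smooth_at_differentiable (sc 0).
have dgg : 'd (fun t : R^o => g (gam t)) 0 1 = dfun g u (eps *: z).
  have dg := smooth_at_differentiable (sgO _ OCu).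
  have nE : \forall t \near (0 : R^o), (g \o cinv C) (line t) = g (gam t) by apply: filterE.
  apply: etrans (diff_comp_near (1 : R^o) (smooth_at_differentiable (sline 0)) dg line0 nE) _.
  by rewrite dline.
have dc : 'd (c : R^o -> _) 0 1 = invmx gu *m dfun g u (eps *: z).
  have lgu : linear (fun M : Mat => invmx gu *m M) by move=> a A B; rewrite linearP.
  exact: diff_lin_comp_eq (@findim_mx R _ _) lgu (smooth_at_differentiable (sgg 0)) dgg.
have Hgam t : Hset R m (g (gam t)).
  by have [_ _ /gP[]] := OE _ (lineO t).
have Hc t : Hset R m (c t) by apply: HsetM => //; exact: HsetV.
have c0 : c 0 = 1%:M by rewrite /c gam0 mulVmx.
split; first exact: lt0r_neq0.
  by rewrite -dc; exact: diff_curve_hLie.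
exists c; split=> //.
- by apply/smooth_onP => //; exact: openT.
- by rewrite deriveE.
(* [G] is the inverse trivialisation read in charts. It sends the pair (base point of [gam], group
   coordinate of [gam]) to the line, and (base point of [u], the same group coordinate) to the orbit
   [act u (c t)]. The two pairs differ only in a base component whose velocity at 0 vanishes because
   z is vertical, so the line and the orbit have equal velocities. *)
have [G [sG GE]] := smooth_prod_onE sPsi Uu Hgu (chart_at_atlas (prj u)) aC
  (chart_at_dom (prj u)) (eq_ind_r (cdom C) uC Psiu).
have cgam : {for 0, continuous (gam : R^o -> P)}.
  apply: continuous_comp; first exact: smooth_at_continuous (sline 0).
  by rewrite line0; exact: cinv_continuous.
have cproj : {for 0, continuous ((fun t => prj (gam t)) : R^o -> N)}.
  by apply: continuous_comp cgam _; rewrite gam0; exact: (proj_smooth_at u).1.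
have cg := smooth_at_continuous (sgg 0).
have near1 : \forall t \near (0 : R^o),
    G (chart_at (prj u) (prj (gam t)), g (gam t)) = line t.
  have cp : ((prj (gam t), g (gam t)) @[t --> (0 : R^o)] --> (prj (gam 0), g (gam 0))).
    exact: (cvg_pair cproj cg).
  rewrite gam0 in cp.
  have := near_cvg cp GE; apply: filterS => t /=.
  have [_ gE Ugam] := OE _ (lineO t); have [_ PsiE _] := gP Ugam.
  by rewrite PsiE => /(_ Ugam (Hgam t))[_ ->].
have near2 : \forall t \near (0 : R^o),
    G (chart_at (prj u) (prj u), g (gam t)) = C (act u (c t)).
  have cp : ((prj u, g (gam t)) @[t --> (0 : R^o)] --> (prj u, g (gam 0))).
    exact: (cvg_pair (cvg_cst _) cg).
  rewrite gam0 in cp.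
  have := near_cvg cp GE; apply: filterS => t /= /(_ Uu (Hgam t))[_ ->]; congr (C _).
  have Uact : U (prj (act u (c t))) by rewrite act_proj.
  have [_ + _] := gP Uact; rewrite act_proj // gact // /c mulmxA mulmxV // mul1mx.
  by move=> ->.
have spp : smooth_at (fun t => chart_at (prj u) (prj (gam t))) (0 : R^o).
  apply: (@smooth_at_comp _ _ _ _ line (fun y => chart_at (prj u) (prj (cinv C y)))) => //.
    exact: findim_mx.
  by rewrite line0; exact: (proj_smooth_at u).2.
have dpp : 'd (fun t => chart_at (prj u) (prj (gam t))) (0 : R^o) 1 = 0.
  have dp := smooth_at_differentiable (proj_smooth_at u).2.
  have nE : \forall t \near (0 : R^o), ((chart_at (prj u) \o prj) \o cinv C) (line t)
      = chart_at (prj u) (prj (gam t)) by apply: filterE.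
  apply: etrans (diff_comp_near (1 : R^o) (smooth_at_differentiable (sline 0)) dp line0 nE) _.
  by rewrite dline linearZ /= -[X in _ *: X = _]/(tmap prj u z) z0 scaler0.
have dG := smooth_at_differentiable sG.
have dp1 := differentiable_pair (smooth_at_differentiable spp)
  (smooth_at_differentiable (sgg 0)).
have dp2 := differentiable_pair (differentiable_cst (chart_at (prj u) (prj u)) (0 : R^o))
  (smooth_at_differentiable (sgg 0)).
have E1 : 'd line 0 1 = 'd G (chart_at (prj u) (prj u), gu) (0, dfun g u (eps *: z)).
  rewrite (diff_comp_near (1 : R^o) dp1 dG _ near1) ?gam0 // diff_pair //=.
    by rewrite dpp dgg.
  - exact: smooth_at_differentiable.
  - exact: smooth_at_differentiable.
rewrite /velocity c0 act1 -/C deriveE; last first.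
  apply: (near_eq_differentiable near2).
  by apply: (differentiable_comp dp2); rewrite /= gam0.
apply: etrans (esym dline) _; apply: etrans E1 _; apply/esym.
rewrite (diff_comp_near (1 : R^o) dp2 dG _ near2) ?gam0 // diff_pair //=.
- by rewrite (diff_cst (chart_at (prj u) (prj u))) dgg.
- exact: smooth_at_differentiable.
Qed.

End Vertical.

(** * The tractor derivative and the isomorphism [Phi_at] *)

Section BundleGeometry.
Context {R : realType} {m k : nat} {N : manifold R m.+1} {P : principal_Hbundle k N}.
Local Notation L := 'cV[R]_(1 + (m + 1)).
Local Notation Mat := 'M[R]_(1 + (m + 1)).
Local Notation TN := 'rV[R]_m.+1.
Local Notation TP := 'rV[R]_k.
Local Notation prj := (@Defs.proj _ _ _ _ P).
Variable omega : P -> TP -> Mat.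
Hypothesis homega : lightlike_cartan omega.
Implicit Types (u : P) (z : TP) (v w : TN) (x : N) (h : Mat) (f : P -> L).

(** In a trivialisation, hold the group coordinate constant at its value at [u]. *)
Lemma local_section u : exists s : N -> P,
  [/\ msmooth_map_at s (prj u), s (prj u) = u & \forall y \near prj u, prj (s y) = y].
Proof.
have [U [g [Psi [[oU Uu] sg sPsi gP PsiP]]]] := local_triv P (prj u).
have [Hg Psiu _] := gP _ Uu.
exists (Psi^~ (g u)); split=> //.
  exact: smooth_prod_on_slice sPsi (findim_mx _ _) oU Uu Hg.
have nU : \forall y \near prj u, U y by exact: open_nbhs_nbhs.
by apply: filterS nU => y Uy; have [] := PsiP _ _ Uy Hg.
Qed.

Lemma tmap_near_id n (M : manifold R n) (f : M -> M) (y : M) (v : 'rV[R]_n) :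
  (\near y, f y = y) -> tmap f y v = v.
Proof.
move=> fy; have fyy := nbhs_singleton fy.
rewrite /tmap fyy -[RHS](dfun_chart_at y); apply/esym/dfun_near.
  by apply: filterS fy => y' /= ->.
exact: msmooth_at_cmap (chart_at_atlas y) (chart_at_dom y).
Qed.

Lemma tmap_linear n n' (M : manifold R n) (M' : manifold R n') (f : M -> M') (y : M) :
  linear (tmap f y).
Proof. exact: dfun_linear. Qed.

Lemma tmap_proj_surj u v : exists z, tmap prj u z = v.
Proof.
have [s [ss su sp]] := local_section u.
exists (tmap s (prj u) v); rewrite -{1}su -tmap_comp //; last exact: proj_smooth_at.
exact: tmap_near_id.
Qed.

Lemma tmap_lift u v : tmap prj u (Defs.lift u v) = v.
Proof. by rewrite /Defs.lift; have [z zv] := tmap_proj_surj u v; case: xgetP => //= /(_ z). Qed.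

Lemma dfun_mulmx_eq n (M : manifold R n) p q r (f : M -> 'M[R]_(p, q))
    (g : M -> 'M[R]_(q, r)) (y : M) (v : 'rV[R]_n) A B :
  msmooth_at f y -> msmooth_at g y -> dfun f y v = A -> dfun g y v = B ->
  dfun (fun y => f y *m g y) y v = A *m g y + f y *m B.
Proof.
move=> /smooth_at_differentiable df /smooth_at_differentiable dg fA gB.
have cy := cmapK (chart_at_dom y).
have fy : (f \o cinv (chart_at y)) (chart_at y y) = f y by rewrite /= cy.
have gy : (g \o cinv (chart_at y)) (chart_at y y) = g y by rewrite /= cy.
exact: diff_mulmx_eq df dg fy gy fA gB.
Qed.

Lemma dfun_lin_comp n (M : manifold R n) (V W : normedModType R) (f : M -> V)
    (l : V -> W) (y : M) (v : 'rV[R]_n) :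
  findim V -> linear l -> msmooth_at f y ->
  dfun (fun y => l (f y)) y v = l (dfun f y v).
Proof.
move=> fV ll /smooth_at_differentiable df.
exact: diff_lin_comp_eq fV ll df erefl.
Qed.

Lemma omega_linear u : linear (omega u).
Proof. by case: homega => -[lo _] _ _ _; exact: lo. Qed.

Lemma omega_gLie u z : gLie R m (omega u z).
Proof. by case: homega => _ /(_ u)[fo _ _] _ _; exact: fo. Qed.

Lemma omega_inj u z z' : omega u z = omega u z' -> z = z'.
Proof. by case: homega => _ /(_ u)[_ io _] _ _; apply: io; rewrite inE. Qed.

Lemma omega_surj u M : gLie R m M -> exists z, omega u z = M.
Proof. by case: homega => _ /(_ u)[_ _ so] _ _ /so[z _ <-]; exists z. Qed.

Lemma omega0 u : omega u 0 = 0.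
Proof. by have [g gE] := linear_packed (@omega_linear u); rewrite gE linear0. Qed.

Lemma omegaB u z z' : omega u (z - z') = omega u z - omega u z'.
Proof. by have [g gE] := linear_packed (@omega_linear u); rewrite gE linearB. Qed.

Lemma omegaZ u a z : omega u (a *: z) = a *: omega u z.
Proof. by have [g gE] := linear_packed (@omega_linear u); rewrite gE linearZ. Qed.

Lemma tractor_smooth f u : tractor_section f -> msmooth_at f u.
Proof. by move=> [/smooth_funP]. Qed.

(* A vertical vector is, up to scale, fundamental; in a local trivialisation
   [f] is the constant-along-fibres section composed with the inverse of the
   group coordinate [g], whose differential is [omega]. *)
Lemma vertical u z : tmap prj u z = 0 ->
  hLie R m (omega u z) /\
  forall f, tractor_section f -> dfun f u z + omega u z *m f u = 0.
Proof.
move=> z0.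
have [U [g [Psi [[oU Uu] sg sPsi gP PsiP]]]] := local_triv P (prj u).
have [eps [eps0 HX fX]] := vertical_fundamental oU sg sPsi gP Uu z0.
have oX : omega u (eps *: z) = invmx (g u) *m dfun g u (eps *: z).
  by case: homega => _ _ _; apply.
have oz : omega u z = invmx (g u) *m dfun g u z.
  have [d dE] := linear_packed (@dfun_linear _ _ _ _ g u).
  move: oX; rewrite omegaZ dE linearZ /= -scalemxAr => /(congr1 (fun M => eps^-1 *: M)).
  by rewrite !scalerA mulVf // !scale1r.
have [Hg Psiu gact] := gP _ Uu; have ug := Hset_unitmx Hg.
split=> [|f tf].
  apply/hLieP; split; first exact: omega_gLie.
  move/hLieP: HX => [_]; rewrite -oX omegaZ -scalemxAl => /eqP.
  by rewrite scaler_eq0 (negbTE eps0) /= => /eqP.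
have ss : msmooth_map_at (Psi^~ (g u)) (prj u).
  exact: smooth_prod_on_slice sPsi (findim_mx _ _) oU Uu Hg.
have fs : msmooth_at (f \o Psi^~ (g u)) (prj u).
  by apply: msmooth_at_comp => //; exact: tractor_smooth.
have sgu : msmooth_at g u by apply: (smooth_fun_onP _ (open_proj_preimage oU)).1 Uu.
pose A u' := invmx (g u) *m g u'.
have lA : linear (fun M : Mat => invmx (g u) *m M) by move=> a B C; rewrite linearP.
have sA : msmooth_at A u by exact: smooth_at_lin (findim_mx _ _) lA sgu.
have dA : dfun A u z = omega u z.
  by rewrite oz; exact: dfun_lin_comp (findim_mx _ _) lA sgu.
have Au : A u = 1%:M by rewrite /A mulVmx.
(* [A u'] is the element of H carrying the point over [prj u'] with group coordinate [g u] to [u'].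
   By equivariance [A u' *m f u'] depends on [prj u'] alone, so its derivative along the vertical z
   is zero, while the product rule at [u] evaluates that derivative to the wanted sum. *)
have nE : \forall u' \near u, ((f \o Psi^~ (g u)) \o prj) u' = A u' *m f u'.
  have nU : \forall u' \near u, U (prj u').
    by apply: open_nbhs_nbhs; split=> //; exact: open_proj_preimage.
  apply: filterS nU => u' Uu' /=; set s := Psi (prj u') (g u).
  have [ps gs] := PsiP _ _ Uu' Hg; have Us : U (prj s) by rewrite /s ps.
  have [Hg' Psiu' _] := gP _ Uu'; have HA : Hset R m (A u') by apply: HsetM; [exact: HsetV|].
  have sE : act s (A u') = u'.
    have Ua : U (prj (act s (A u'))) by rewrite act_proj.
    have [_ _ gs'] := gP _ Us; have [_ + _] := gP _ Ua.
    by rewrite gs' // act_proj // /s ps gs /A mulmxA mulmxV // mul1mx Psiu' => <-.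
  have fE : f u' = invmx (A u') *m f s by rewrite -{1}sE; apply: tf.2.
  rewrite fE mulmxA mulmxV ?mul1mx //.
  exact: Hset_unitmx.
have E1 : dfun ((f \o Psi^~ (g u)) \o prj) u z = 0.
  by rewrite dfun_comp // ?z0 ?dfun0 //; exact: proj_smooth_at.
have E2 := dfun_mulmx_eq sA (tractor_smooth u tf) dA (erefl (dfun f u z)).
rewrite Au mul1mx addrC in E2; rewrite -E2 -E1; apply/esym/dfun_near => //.
by apply: msmooth_at_comp => //; exact: proj_smooth_at.
Qed.

Lemma nabla_at_tmap u z f : tractor_section f ->
  nabla_at omega u (tmap prj u z) f = dfun f u z + omega u z *m f u.
Proof.
move=> tf; rewrite /nabla_at; set z' := Defs.lift u _.
have [T TE] := linear_packed (@tmap_linear _ _ _ _ prj u).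
have [d dE] := linear_packed (@dfun_linear _ _ _ _ f u).
have v0 : tmap prj u (z - z') = 0.
  by rewrite TE linearB /= -TE tmap_lift subrr.
have [_ /(_ f tf)] := vertical v0.
rewrite dE linearB /= -dE omegaB mulmxBl addrACA -opprD => /eqP.
by rewrite subr_eq0 => /eqP.
Qed.

Lemma tractor_xi : tractor_section (@xi _ _ _ _ P).
Proof.
split=> [|u h Hh]; last by rewrite invmx_ell.
by apply/smooth_funP => u; exact: smooth_at_cst.
Qed.

Lemma dfun_cst n (M : manifold R n) (V : normedModType R) (a : V) (y : M) (v : 'rV[R]_n) :
  dfun (fun=> a) y v = 0.
Proof. by rewrite /dfun (diff_cst a). Qed.

Lemma Phi_at_tmap u z : Phi_at omega u (tmap prj u z) = omega u z *m ell.
Proof. by rewrite /Phi_at nabla_at_tmap ?dfun_cst ?add0r //; exact: tractor_xi. Qed.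

Lemma Phi_atE u v : Phi_at omega u v = lcol (phi omega u v).1 (phi omega u v).2 0.
Proof. by rewrite -{1}(tmap_lift u v) Phi_at_tmap gLie_ell //; exact: omega_gLie. Qed.

Lemma nabla_at_linear u f : tractor_section f -> linear (nabla_at omega u ^~ f).
Proof.
move=> tf a v w; rewrite -(tmap_lift u v) -(tmap_lift u w) -tmap_linear.
rewrite !nabla_at_tmap // dfun_linear omega_linear mulmxDl -scalemxAl.
by rewrite scalerDr addrACA.
Qed.

Lemma Phi_at_linear u : linear (Phi_at omega u).
Proof. exact: nabla_at_linear tractor_xi. Qed.

Lemma Phi_at_surj u a X : exists v, Phi_at omega u v = lcol a X 0.
Proof.
have [z zE] := omega_surj u (gmat_gLie a X).
exists (tmap prj u z); rewrite Phi_at_tmap zE gLie_ell ?gh_proj_gmat //.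
exact: gmat_gLie.
Qed.

(* [Phi_at u] is a surjection between spaces of the same dimension [m.+1]. *)
Lemma Phi_at_inj u v w : Phi_at omega u v = Phi_at omega u w -> v = w.
Proof.
have [F FE] := linear_packed (@Phi_at_linear u).
(* The values of [Phi_at] have last coordinate 0. Dropping it turns the map into a square matrix,
   for which full rank is the same as freeness. *)
pose cut (e : L) : 'rV[R]_(1 + m) := (col_mx (usubmx e) (usubmx (dsubmx e)))^T.
have lcut : linear cut.
  by move=> a e e'; apply/rowP => i; rewrite !mxE; case: (fintype.split i) => j; rewrite !mxE.
have [Cu CuE] := linear_packed lcut.
have cutE a X b : cut (lcol a X b) = row_mx a%:M X^T.
  by rewrite /cut /lcol col_mxKu col_mxKd col_mxKu tr_col_mx tr_scalar_mx.
have fE y : y *m lin1_mx (Cu \o F) = cut (Phi_at omega u y).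
  by rewrite mul_rV_lin1 /= -CuE -FE.
have full : row_full (lin1_mx (Cu \o F)).
  apply/row_fullP.
  have sol (i : 'I_(1 + m)) : exists y : 'rV[R]_m.+1, y *m lin1_mx (Cu \o F) = delta_mx 0 i.
    have [y yE] := Phi_at_surj u (lsubmx (delta_mx 0 i : 'rV[R]_(1 + m)) 0 0)
       (rsubmx (delta_mx 0 i : 'rV[R]_(1 + m)))^T.
    exists y; rewrite fE yE cutE trmxK -mx11_scalar hsubmxK //.
  exists (\matrix_i (sval (cid (sol i)))); apply/row_matrixP => i.
  by rewrite row_mul rowK (svalP (cid (sol i))) row1.
have free : row_free (lin1_mx (Cu \o F)) by rewrite row_free_unit -row_full_unit.
by move=> vw; apply: (row_free_inj free); rewrite !fE vw.
Qed.

Lemma act_smooth_at u h : Hset R m h -> msmooth_map_at (fun u' => act u' h : P) u.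
Proof.
move=> Hh.
exact: (smooth_prod_on_slice (@act_smooth _ _ _ _ P) (@findim_mx R _ _) openT
  (Logic.I : setT u) Hh).
Qed.

(** The right translate by h of a lift at [u] is a lift of the same vector at [act u h]. There the
    Ad-equivariance of [omega] and the differentiated equivariance of [f] both produce the factor
    h^-1. *)
Lemma nabla_at_act u h v f : Hset R m h -> tractor_section f ->
  nabla_at omega (act u h) v f = invmx h *m nabla_at omega u v f.
Proof.
move=> Hh tf; have [z zv] := tmap_proj_surj u v; have uh := Hset_unitmx Hh.
have sh := act_smooth_at u Hh.
have pE : (prj \o (fun u' => act u' h : P)) = prj by apply/funext => u' /=; exact: act_proj.
have zvh : tmap prj (act u h) (tmap ((fun u' => act u' h : P)) u z) = v.
  by rewrite -tmap_comp ?pE //; exact: proj_smooth_at.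
rewrite -{1}zvh -zv !nabla_at_tmap //.
case: homega => _ _ /(_ u h z Hh) -> _; have [_ fH] := tf.
rewrite fH // -!mulmxA mulKVmx // mulmxDr; congr (_ + _).
rewrite -dfun_comp //; last exact: tractor_smooth.
have -> : f \o (fun u' => act u' h : P) = fun u' => invmx h *m f u'.
  by apply/funext => u' /=; exact: fH.
apply: dfun_lin_comp; [exact: findim_mx | | exact: tractor_smooth].
by move=> a B C; rewrite linearP.
Qed.

Lemma Phi_at_act u h v : Hset R m h ->
  Phi_at omega (act u h) v = invmx h *m Phi_at omega u v.
Proof. by move=> Hh; apply: nabla_at_act => //; exact: tractor_xi. Qed.

(** [Zvec] is chosen at one point of each fibre; the equation passes to every other point because H
    fixes [ell]. *)
Lemma Phi_at_Zvec u : Phi_at omega u (Zvec omega (prj u)) = ell.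
Proof.
have pf : prj (fibre_pt P (prj u)) = prj u by rewrite /fibre_pt; case: cid.
have [h Hh uE] := act_trans pf.
have ZE : Phi_at omega (fibre_pt P (prj u)) (Zvec omega (prj u)) = ell.
  rewrite /Zvec; have [v vE] := Phi_at_surj (fibre_pt P (prj u)) 1 0.
  move: vE; rewrite Phi_atE => /lcol_inj[v1 v2 _].
  have {v1 v2} ph : phi omega (fibre_pt P (prj u)) v = (1, 0).
    by rewrite [LHS]surjective_pairing v1 v2.
  case: xgetP => [w _ /= wE|/(_ v)//].
  by rewrite Phi_atE wE.
by rewrite {1}uE Phi_at_act // ZE invmx_ell.
Qed.

Lemma hmetE u v w :
  hmet omega (prj u) v w = lprod (Phi_at omega u v) (Phi_at omega u w).
Proof.
have pf : prj (fibre_pt P (prj u)) = prj u by rewrite /fibre_pt; case: cid.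
have [h Hh uE] := act_trans pf.
rewrite [in RHS]uE !Phi_at_act // lprod_invmx // /hmet !Phi_atE -qformE.
by rewrite -!surjective_pairing.
Qed.

End BundleGeometry.

(** * Smoothness on the bundle and on the base *)

Section Smoothness.
Context {R : realType} {m k : nat} {N : manifold R m.+1} {P : principal_Hbundle k N}.
Local Notation L := 'cV[R]_(1 + (m + 1)).
Local Notation Mat := 'M[R]_(1 + (m + 1)).
Local Notation TN := 'rV[R]_m.+1.
Local Notation TP := 'rV[R]_k.
Local Notation prj := (@Defs.proj _ _ _ _ P).
Variable omega : P -> TP -> Mat.
Hypothesis homega : lightlike_cartan omega.
Implicit Types (u : P) (z : TP) (v w : TN) (x : N) (h : Mat) (f : P -> L).

Lemma linear_rowE n (V : lmodType R) (g : 'rV[R]_n -> V) (e : 'rV[R]_n) :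
  linear g -> g e = \sum_i e 0 i *: g (delta_mx 0 i).
Proof.
move=> lg; pose gM := GRing.isLinear.Build R 'rV[R]_n V _ g lg.
pose G : {linear 'rV[R]_n -> V} := HB.pack g gM.
rewrite -[g]/(G : _ -> _) {1}(row_sum_delta e) linear_sum.
by apply: eq_bigr => i _; rewrite linearZ.
Qed.

(* In a chart [omega] is a matrix K with independent rows, hence it has the
   smooth right inverse K^T (K K^T)^-1. *)
Lemma smooth_omega_inv (M : P -> Mat) (Z : P -> TP) u :
  msmooth_at M u -> (forall u, omega u (Z u) = M u) ->
  msmooth_at (fun u' => dfun (chart_at u) u' (Z u')) u.
Proof.
move=> sM oZ; set c := chart_at u.
have ac : atlas c := chart_at_atlas u; have cu : cdom c u := chart_at_dom u.
pose K u' := \matrix_(i < k) mxvec (omega u' (coord_vec c u' (delta_mx 0 i))).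
have lK u' : linear (fun e => mxvec (omega u' (coord_vec c u' e))).
  by move=> a e e'; rewrite coord_vec_linear (omega_linear homega) linearP.
have KE u' e : e *m K u' = mxvec (omega u' (coord_vec c u' e)).
  rewrite (linear_rowE e (lK u')) mulmx_sum_row.
  by apply: eq_bigr => i _; rewrite rowK.
have freeK u' : cdom c u' -> row_free (K u').
  move=> cu'; rewrite -kermx_eq0; apply/eqP/row_matrixP => i; rewrite row0.
  set e := row i _; have : e *m K u' = 0 by rewrite /e -row_mul mulmx_ker row0.
  rewrite KE => /(congr1 vec_mx); rewrite mxvecK linear0 -(omega0 homega u').
  move=> /(omega_inj homega) /(congr1 (dfun c u')).
  by rewrite coord_vecK // dfun0.
have lmv : linear (@mxvec R (1 + (m + 1)) (1 + (m + 1))).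
  by move=> a A B; rewrite linearP.
have sK : msmooth_at K u.
  apply: smooth_at_mx => i j.
  apply: (@smooth_at_eq _ _ _ (fun y =>
    (mxvec (omega (cinv c y) (coord_vec c (cinv c y) (delta_mx 0 i)))) 0 j)).
    by apply: filterE => y; rewrite /= mxE.
  apply: smooth_at_coord; apply: (smooth_at_lin (@findim_mx R _ _) lmv).
  case: homega => -[_ so] _ _ _.
  have /smooth_fun_onP := so c ac (delta_mx 0 i).
  by move=> /(_ (cdom_open c)) /(_ u cu).
apply: (@msmooth_at_eq _ _ _ _
  (fun u' => mxvec (M u') *m (K u')^T *m invmx (K u' *m (K u')^T))).
  apply: filterS (near_cdom cu) => u' cu'.
  rewrite -oZ -[in mxvec _](dfunK (Z u') ac cu') -KE.
  rewrite -!mulmxA mulmxA mulmxA -(mulmxA _ _ (K u')^T).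
  by rewrite mulmxK //; apply: gram_unitmx; exact: freeK.
apply: smooth_at_mulmx; first apply: smooth_at_mulmx.
- exact: (smooth_at_lin (@findim_mx R _ _) lmv sM).
- exact: smooth_at_tr.
apply: smooth_at_invmx; first by rewrite /= cmapK //; apply: gram_unitmx; exact: freeK.
by apply: smooth_at_mulmx => //; exact: smooth_at_tr.
Qed.

Definition vsmooth_at (W : N -> TN) x : Prop :=
  msmooth_at (fun y => dfun (chart_at x) y (W y)) x.

(** The lift chosen by [lift] may be discontinuous. In charts the differential of the projection is
    right multiplication by a matrix J of full column rank, and w (J^T J)^-1 J^T is the solution of
    zeta J = w of least Euclidean norm, smooth in all data. *)
Lemma smooth_lift (W : N -> TN) u : vsmooth_at W (prj u) ->
  exists Z : P -> TP, (\forall u' \near u, tmap prj u' (Z u') = W (prj u')) /\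
    msmooth_at (fun u' => dfun (chart_at u) u' (Z u')) u.
Proof.
move=> sW; set C := chart_at u; set c := chart_at (prj u).
have aC : atlas C := chart_at_atlas u; have Cu : cdom C u := chart_at_dom u.
have ac : atlas c := chart_at_atlas (prj u); have cu : cdom c (prj u) := chart_at_dom _.
pose J u' : 'M[R]_(k, m.+1) :=
  \matrix_(i < k) dfun (c \o prj) u' (coord_vec C u' (delta_mx 0 i)).
have JE u' e : e *m J u' = dfun (c \o prj) u' (coord_vec C u' e).
  have lJ : linear (fun e => dfun (c \o prj) u' (coord_vec C u' e)).
    by move=> a e1 e2; rewrite coord_vec_linear dfun_linear.
  rewrite (linear_rowE e lJ) mulmx_sum_row.
  by apply: eq_bigr => i _; rewrite rowK.
have scp u' : cdom c (prj u') -> msmooth_at (c \o prj) u'.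
  by move=> cu'; apply: msmooth_at_chart => //; exact: proj_smooth_at.
have dcp u' z : cdom c (prj u') -> dfun (c \o prj) u' z = dfun c (prj u') (tmap prj u' z).
  by move=> cu'; rewrite dfun_comp; [|exact: proj_smooth_at|exact: msmooth_at_cmap].
have fullJ u' : cdom C u' -> cdom c (prj u') -> row_free (J u')^T.
  move=> Cu' cu'; rewrite -[row_free _]/(_ == _) mxrank_tr -[_ == _]/(row_full (J u')).
  apply/row_fullP.
  have sol (i : 'I_m.+1) : exists e : 'rV[R]_k, e *m J u' = delta_mx 0 i.
    have [z zE] := tmap_proj_surj u' (coord_vec c (prj u') (delta_mx 0 i)).
    by exists (dfun C u' z); rewrite JE dfunK // dcp // zE coord_vecK.
  exists (\matrix_i (sval (cid (sol i)))); apply/row_matrixP => i.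
  by rewrite row_mul rowK (svalP (cid (sol i))) row1.
have nc : \forall u' \near u, cdom c (prj u').
  by have [cp _] := proj_smooth_at u; exact: (near_cvg cp (near_cdom cu)).
have sJ : msmooth_at J u.
  apply: smooth_at_mx => i j.
  apply: (@smooth_at_eq _ _ _ (fun y =>
    (dfun (c \o prj) (cinv C y) (coord_vec C (cinv C y) (delta_mx 0 i))) 0 j)).
    by apply: filterE => y; rewrite /= mxE.
  apply: smooth_at_coord.
  apply: (@msmooth_at_dfun _ _ _ C _ (c \o prj)
    (fun u' => coord_vec C u' (delta_mx 0 i)) u aC Cu); last exact: scp.
  apply: (@msmooth_at_eq _ _ _ _ (fun=> delta_mx 0 i)); last exact: smooth_at_cst.
  by apply: filterS (near_cdom Cu) => u' Cu'; rewrite coord_vecK.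
pose wv u' := dfun c (prj u') (W (prj u')).
pose zeta u' := wv u' *m invmx ((J u')^T *m J u') *m (J u')^T.
have nC := near_cdom Cu.
have unitJ u' : cdom C u' -> cdom c (prj u') -> (J u')^T *m J u' \in unitmx.
  by move=> Cu' cu'; rewrite -{2}(trmxK (J u')); apply: gram_unitmx; exact: fullJ.
exists (fun u' => coord_vec C u' (zeta u')); split.
  apply: filterS2 nc nC => u' cu' Cu'.
  rewrite -[LHS](dfunK _ ac cu') -dcp // -JE /zeta -!mulmxA mulVmx ?unitJ //.
  by rewrite mulmx1 dfunK.
apply: (@msmooth_at_eq _ _ _ _ zeta).
  by apply: filterS nC => u' Cu'; rewrite coord_vecK.
have sJT : msmooth_at (fun u' => (J u')^T) u by exact: smooth_at_tr.
apply: smooth_at_mulmx => //; apply: smooth_at_mulmx.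
  exact: (msmooth_at_comp (proj_smooth_at u) (f := fun y => dfun c y (W y))).
apply: smooth_at_invmx; first by rewrite /= cmapK //; exact: unitJ.
exact: smooth_at_mulmx.
Qed.

Lemma msmooth_at_descent (V : normedModType R) (f : N -> V) u :
  msmooth_at (f \o prj) u -> msmooth_at f (prj u).
Proof.
move=> sf; have [s [ss su sp]] := local_section u.
apply: (@msmooth_at_eq _ _ _ _ ((f \o prj) \o s)).
  by apply: filterS sp => y /= ->.
by apply: msmooth_at_comp => //; rewrite su.
Qed.

Lemma nabla_at_smooth (W : N -> TN) f u : vsmooth_at W (prj u) ->
  tractor_section f -> msmooth_at (fun u' => nabla_at omega u' (W (prj u')) f) u.
Proof.
move=> /smooth_lift[Z [ZW sZ]] tf.
have ac := chart_at_atlas u; have cu := chart_at_dom u.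
apply: (@msmooth_at_eq _ _ _ _ (fun u' => dfun f u' (Z u') + omega u' (Z u') *m f u')).
  by apply: filterS ZW => u' <-; rewrite nabla_at_tmap.
apply: smooth_atD; first exact: (msmooth_at_dfun ac cu sZ (tractor_smooth u tf)).
apply: smooth_at_mulmx; last exact: (tractor_smooth u tf).
by case: homega => so _ _ _; exact: (msmooth_at_form ac cu so sZ).
Qed.

(** For e orthogonal to [ell], this is an element of the Lorentz algebra sending [ell] to e. Being
    linear in e, it preserves smoothness. *)
Definition glift (e : L) : Mat := gmat (usubmx e 0 0) 0 (usubmx (dsubmx e)) 0.

Lemma glift_linear : linear glift.
Proof.
move=> a e e'.
have E0 : usubmx (a *: e + e') 0 0 = a * usubmx e 0 0 + usubmx e' 0 0.
  by rewrite linearP !mxE.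
have E1 : usubmx (dsubmx (a *: e + e')) = a *: usubmx (dsubmx e) + usubmx (dsubmx e').
  by rewrite !linearP.
rewrite /glift /gmat {}E0 {}E1 !scale_block_mx !add_block_mx !trmx0 !oppr0 !scaler0 !addr0.
rewrite !scale_row_mx !add_row_mx !scale_col_mx !add_col_mx !scaler0 !addr0.
by rewrite !scalerN -!opprD linearP /= scale_scalar_mx -raddfD.
Qed.

Lemma glift_ell a X : glift (lcol a X 0) *m ell = lcol a X 0.
Proof.
rewrite gLie_ell; last exact: gmat_gLie.
by rewrite gh_proj_gmat /lcol /= col_mxKu col_mxKd col_mxKu mxE mulr1n.
Qed.

(** Solve omega(Z) = [glift] of Phi(Y) on P, which is smooth in the point; injectivity of [Phi_at]
    shows that Z projects to Y. Fields defined by choice thus become smooth as soon as their images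
    under Phi are. *)
Lemma smooth_of_Phi (Y : N -> TN) u (c : chart R N m.+1) :
  atlas c -> cdom c (prj u) ->
  msmooth_at (fun u' => Phi_at omega u' (Y (prj u'))) u ->
  msmooth_at (fun y => dfun c y (Y y)) (prj u).
Proof.
move=> ac cu sY; apply: msmooth_at_descent.
pose Z u' := sval (cid (omega_surj homega u' (gmat_gLie
  (usubmx (Phi_at omega u' (Y (prj u'))) 0 0)
  (usubmx (dsubmx (Phi_at omega u' (Y (prj u')))))))).
have ZE u' : omega u' (Z u') = glift (Phi_at omega u' (Y (prj u'))) by rewrite /Z; case: cid.
have sM : msmooth_at (fun u' => glift (Phi_at omega u' (Y (prj u')))) u.
  exact: (smooth_at_lin (@findim_mx R _ _) glift_linear sY).
have sZ := smooth_omega_inv sM ZE.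
have tZ u' : tmap prj u' (Z u') = Y (prj u').
  apply: (Phi_at_inj homega (u := u')); rewrite Phi_at_tmap // ZE.
  by rewrite (Phi_atE homega) glift_ell.
have nc : \forall u' \near u, cdom c (prj u').
  by have [cp _] := proj_smooth_at u; exact: (near_cvg cp (near_cdom cu)).
apply: (@msmooth_at_eq _ _ _ _ (fun u' => dfun (c \o prj) u' (Z u'))).
  apply: filterS nc => u' cu'; rewrite dfun_comp ?tZ //.
    exact: proj_smooth_at.
  exact: msmooth_at_cmap.
apply: (msmooth_at_dfun (chart_at_atlas u) (chart_at_dom u) sZ).
by apply: msmooth_at_chart => //; exact: proj_smooth_at.
Qed.

End Smoothness.

(** * The null section determined by tau *)

Section Eta.
Context {R : realType} {m k : nat} {N : manifold R m.+1} {P : principal_Hbundle k N}.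
Local Notation L := 'cV[R]_(1 + (m + 1)).
Local Notation Mat := 'M[R]_(1 + (m + 1)).
Local Notation TN := 'rV[R]_m.+1.
Local Notation TP := 'rV[R]_k.
Local Notation prj := (@Defs.proj _ _ _ _ P).
Variable omega : P -> TP -> Mat.
Hypothesis homega : lightlike_cartan omega.
Variable tau : N -> TN -> R.
Hypothesis htau : Sforms omega tau.
Implicit Types (u : P) (z : TP) (v w : TN) (x : N) (h : Mat) (f g : P -> L).

Lemma tau_linear x : linear (tau x : TN -> R^o).
Proof. by have [[lt _] _] := htau; exact: lt. Qed.

Lemma tauD x v w : tau x (v + w) = tau x v + tau x w.
Proof. by have := tau_linear x 1 v w; rewrite !scale1r. Qed.

Lemma tauZ x a v : tau x (a *: v) = a * tau x v.
Proof. by have [t tE] := linear_packed (@tau_linear x); rewrite tE linearZ. Qed.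

Lemma tauB x v w : tau x (v - w) = tau x v - tau x w.
Proof. by rewrite -scaleN1r tauD tauZ mulN1r. Qed.

Lemma tau_Zvec x : tau x (Zvec omega x) = 1.
Proof. by have [_ ->] := htau. Qed.

Lemma tau_Ptau x v : tau x (Ptau omega tau x v) = 0.
Proof. by rewrite /Ptau tauB tauZ tau_Zvec mulr1 subrr. Qed.

Lemma Phi_atD u v w : Phi_at omega u (v + w) = Phi_at omega u v + Phi_at omega u w.
Proof. by have := Phi_at_linear homega u 1 v w; rewrite !scale1r. Qed.

Lemma Phi_atZ u a v : Phi_at omega u (a *: v) = a *: Phi_at omega u v.
Proof. by have [t tE] := linear_packed (Phi_at_linear homega u); rewrite tE linearZ. Qed.

Lemma Phi_at_split u v : Phi_at omega u v =
  Phi_at omega u (Ptau omega tau (prj u) v) + tau (prj u) v *: ell.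
Proof.
by rewrite -[X in _ *: X](Phi_at_Zvec homega u) -Phi_atZ -Phi_atD /Ptau subrK.
Qed.

Lemma smooth_tau_proj (Z : P -> TP) u :
  msmooth_at (fun u' => dfun (chart_at u) u' (Z u')) u ->
  msmooth_at ((fun u' => tau (prj u') (tmap prj u' (Z u'))) : P -> R^o) u.
Proof.
move=> sZ; set c := chart_at (prj u).
have ac : atlas c := chart_at_atlas (prj u); have cu : cdom c (prj u) := chart_at_dom _.
have nc : \forall u' \near u, cdom c (prj u').
  by have [cp _] := proj_smooth_at u; exact: (near_cvg cp (near_cdom cu)).
have scp : msmooth_at (c \o prj) u.
  by apply: msmooth_at_chart => //; exact: proj_smooth_at.
apply: (@msmooth_at_eq _ _ _ R^o (fun u' => \sum_i (dfun (c \o prj) u' (Z u')) 0 i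
    *: (tau (prj u') (coord_vec c (prj u') (delta_mx 0 i)) : R^o))).
  apply: filterS nc => u' cu'.
  have lt : linear (fun e => tau (prj u') (coord_vec c (prj u') e) : R^o).
    by move=> a e e'; rewrite coord_vec_linear tau_linear.
  rewrite -(linear_rowE _ lt) dfun_comp ?dfunK //; first exact: proj_smooth_at.
  exact: msmooth_at_cmap.
apply: smooth_at_sum => i _; apply: smooth_atZ.
  apply: smooth_at_coord.
  exact: (msmooth_at_dfun (chart_at_atlas u) (chart_at_dom u) sZ scp).
apply: (msmooth_at_comp (proj_smooth_at u)
  (f := (fun y => tau y (coord_vec c y (delta_mx 0 i))) : N -> R^o)).
have [[_ st] _] := htau.
have /smooth_fun_onP := st c ac (delta_mx 0 i).
by move=> /(_ (cdom_open c)) /(_ _ cu).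
Qed.

(* [e u] has component 1 along n because <ell, e> = 1; writing tau as
   (a, X) |-> a + X^T theta in the frame u forces its middle component to be
   theta, and <e, e> = 0 its first one. *)
Lemma eta_exists : exists e, is_eta omega tau e.
Proof.
pose E i : Mat := gmat 0 0 (delta_mx i 0) 0.
pose Z i u := sval (cid (omega_surj homega u (gmat_gLie 0 (delta_mx i 0)))).
have ZE i u : omega u (Z i u) = E i by rewrite /Z; case: cid.
pose V i u := tmap prj u (Z i u).
have PhiV i u : Phi_at omega u (V i u) = lcol 0 (delta_mx i 0) 0.
  by rewrite Phi_at_tmap // ZE gLie_ell ?gh_proj_gmat //; exact: gmat_gLie.
pose th u : 'cV[R]_m := \col_i tau (prj u) (V i u).
pose e u := lcol (- (dotp (th u) (th u) / 2)) (th u) 1.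
have eE u v : lprod (Phi_at omega u v) (e u) = tau (prj u) v.
  rewrite Phi_atE //; set a := (phi _ _ _).1; set X := (phi _ _ _).2.
  (* Z and the vectors V_i form a frame, their images under Phi being [ell] and the e_i; the
     expansion is checked after the injective map [Phi_at]. *)
  have vE : v = a *: Zvec omega (prj u) + \sum_i X i 0 *: V i u.
    apply: (Phi_at_inj homega (u := u)).
    have [F FE] := linear_packed (Phi_at_linear homega u).
    rewrite Phi_atD Phi_atZ Phi_at_Zvec // FE linear_sum.
    have -> : \sum_i F (X i 0 *: V i u) = lcol 0 X 0.
      by under eq_bigr do rewrite linearZ /= -FE PhiV; exact: lcol_mid_sum.
    by rewrite -FE Phi_atE // /ell lcolZ lcolD !mulr1 scaler0 add0r mulr0 !addr0.
  have [t tE] := linear_packed (@tau_linear (prj u)).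
  rewrite lprodE mulr1 mul0r addr0 [in RHS]vE tauD tauZ tau_Zvec mulr1; congr (_ + _).
  rewrite tE linear_sum /dotp mxE; apply: eq_bigr => i _.
  by rewrite linearZ /= -tE !mxE.
have sth u : msmooth_at th u.
  apply: smooth_at_mx => i j.
  apply: (@smooth_at_eq _ _ R^o (fun y =>
    tau (prj (cinv (chart_at u) y)) (V i (cinv (chart_at u) y)))).
    by apply: filterE => y; rewrite /= mxE.
  apply: smooth_tau_proj; apply: (smooth_omega_inv homega (M := fun=> E i)) => //.
  exact: smooth_at_cst.
have se u : msmooth_at e u.
  apply: (@msmooth_at_eq _ _ _ _
    (fun u => - (dotp (th u) (th u) / 2) *: ell + lcol 0 (th u) 0 + 1 *: nvec)).
    by apply: filterE => u'; rewrite -lcolE.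
  apply: smooth_atD; last exact: smooth_at_cst.
  apply: smooth_atD; last exact: (smooth_at_lin (@findim_mx R _ _) lcol_mid_linear (sth u)).
  apply: smooth_atZ; last exact: smooth_at_cst.
  apply: (@smooth_at_eq _ _ R^o (fun y => (- 2^-1 : R) *
    ((th (cinv (chart_at u) y))^T *m th (cinv (chart_at u) y)) 0 0)).
    by apply: filterE => y /=; rewrite /dotp mulNr mulrC.
  apply: smooth_atM; first exact: smooth_at_cst.
  by apply: smooth_at_coord; apply: smooth_at_mulmx; [apply: smooth_at_tr|]; exact: sth.
have e0 u : lprod (e u) (e u) = 0 by rewrite lprodE; lra.
have e1 u : lprod ell (e u) = 1 by rewrite lprod_ell_lcol.
exists e; split=> // [|u v]; last by rewrite eE => ->.
split=> [|u h Hh]; first exact/smooth_funP.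
(* Equivariance follows from uniqueness: e(u h) and h^-1 e(u) satisfy the same conditions in the
   frame u h. *)
apply: null_pairing_uniq => //.
- by rewrite lprod_invmx.
- by rewrite -{1}(invmx_ell Hh) lprod_invmx.
move=> X; have [v vE] := Phi_at_surj homega (act u h) 0 X.
(* Projecting along Z puts the test vector in the kernel of tau and only shifts its
   [ell]-coefficient, which is where the free coefficient of [null_pairing_uniq] comes from. *)
pose w := Ptau omega tau (prj (act u h)) v.
have wE : Phi_at omega (act u h) w = lcol (- tau (prj (act u h)) v) X 0.
  apply: (addIr (tau (prj (act u h)) v *: ell)).
  by rewrite -Phi_at_split vE /ell lcolZ lcolD mulr1 addNr scaler0 mulr0 !addr0.
exists (- tau (prj (act u h)) v); rewrite -wE; split; first by rewrite eE tau_Ptau.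
by rewrite Phi_at_act // lprod_invmx // eE -(act_proj u Hh) tau_Ptau.
Qed.

Local Notation et := (eta omega tau).

Lemma eta_spec : is_eta omega tau et.
Proof. by have [e He] := eta_exists; rewrite /eta; case: xgetP => // /(_ e). Qed.

Lemma tractor_eta : tractor_section et.
Proof. by have [] := eta_spec. Qed.

Lemma eta_null u : lprod (et u) (et u) = 0.
Proof. by have [_ ->] := eta_spec. Qed.

Lemma lprod_ell_eta u : lprod ell (et u) = 1.
Proof. by have [_ _ ->] := eta_spec. Qed.

Lemma lprod_Phi_eta u v : lprod (Phi_at omega u v) (et u) = tau (prj u) v.
Proof.
rewrite Phi_at_split lprodDl lprodZl lprod_ell_eta mulr1.
by have [_ _ _ ->] := eta_spec; rewrite ?add0r //; exact: tau_Ptau.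
Qed.

Lemma lprod_ell_Phi u v : lprod ell (Phi_at omega u v) = 0.
Proof. by rewrite Phi_atE // lprod_ell_lcol. Qed.

End Eta.

(** * The tractor connection in the decomposition *)

Section TractorCalculus.
Context {R : realType} {m k : nat} {N : manifold R m.+1} {P : principal_Hbundle k N}.
Local Notation L := 'cV[R]_(1 + (m + 1)).
Local Notation Mat := 'M[R]_(1 + (m + 1)).
Local Notation TN := 'rV[R]_m.+1.
Local Notation TP := 'rV[R]_k.
Local Notation prj := (@Defs.proj _ _ _ _ P).
Variable omega : P -> TP -> Mat.
Hypothesis homega : lightlike_cartan omega.
Implicit Types (u : P) (z : TP) (v w : TN) (x : N) (h : Mat) (f g : P -> L).

Lemma smooth_vfield_at (W : N -> TN) x : smooth_vfield W -> vsmooth_at W x.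
Proof.
move=> sW; have /smooth_fun_onP := sW _ (chart_at_atlas x).
by move=> /(_ (cdom_open _)) /(_ _ (chart_at_dom x)).
Qed.

Lemma tractor_nablaT (W : N -> TN) f : smooth_vfield W -> tractor_section f ->
  tractor_section (nablaT omega W f).
Proof.
move=> sW tf; split=> [|u h Hh]; last by rewrite /nablaT act_proj // nabla_at_act.
apply/smooth_funP => u; apply: nabla_at_smooth => //.
exact: smooth_vfield_at.
Qed.

Lemma tractor_Phi (W : N -> TN) : smooth_vfield W -> tractor_section (Phi omega W).
Proof. by move=> sW; apply: tractor_nablaT => //; exact: tractor_xi. Qed.

Lemma dfunD n (M : manifold R n) (V : normedModType R) (f g : M -> V) (y : M)
    (v : 'rV[R]_n) : msmooth_at f y -> msmooth_at g y ->
  dfun (fun y => f y + g y) y v = dfun f y v + dfun g y v.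
Proof.
move=> /smooth_at_differentiable df /smooth_at_differentiable dg.
exact: (congr1 (@^~ v) (diffD df dg)).
Qed.

Lemma dfunZ n (M : manifold R n) p q (f : M -> R) (g : M -> 'M[R]_(p, q)) (y : M)
    (v : 'rV[R]_n) : msmooth_at (f : M -> R^o) y -> msmooth_at g y ->
  dfun (fun y => f y *: g y) y v = dfun (f : M -> R^o) y v *: g y + f y *: dfun g y v.
Proof.
move=> sf sg.
(* Scaling by [f] is left multiplication by the scalar matrix with entry [f], which reduces the
   claim to the matrix product rule. *)
have lsc : linear (fun a : R^o => a%:M : 'M[R]_p).
  by move=> a b c; rewrite raddfD /= -scale_scalar_mx.
have sfM : msmooth_at (fun y => (f y)%:M : 'M[R]_p) y.
  exact: smooth_at_lin (@findim_R R) lsc sf.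
have dfM := dfun_lin_comp v (@findim_R R) lsc sf.
have Ef : (fun y => (f y)%:M *m g y) = fun y => f y *: g y.
  by apply/funext => y'; rewrite mul_scalar_mx.
rewrite -Ef; apply: etrans (dfun_mulmx_eq sfM sg dfM (erefl (dfun g y v))) _.
by rewrite !mul_scalar_mx.
Qed.

Lemma nabla_atD u v f g : tractor_section f -> tractor_section g ->
  nabla_at omega u v (fun u => f u + g u) = nabla_at omega u v f + nabla_at omega u v g.
Proof.
move=> tf tg; rewrite /nabla_at dfunD; [|exact: tractor_smooth..].
by rewrite mulmxDr addrACA.
Qed.

Lemma nabla_atZ u v (a : N -> R) f : smoothR a -> tractor_section f ->
  nabla_at omega u v (fun u => a (prj u) *: f u)
  = dfun (a : N -> R^o) (prj u) v *: f u + a (prj u) *: nabla_at omega u v f.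
Proof.
move=> /smooth_funP sa tf.
have sap : msmooth_at ((a : N -> R^o) \o prj) u.
  by apply: msmooth_at_comp; [exact: proj_smooth_at | exact: sa].
rewrite /nabla_at (dfunZ _ sap (tractor_smooth u tf)).
rewrite (dfun_comp (proj_smooth_at u) _ (sa (prj u))) tmap_lift -scalemxAr.
by rewrite scalerDr addrA.
Qed.

Lemma dfun_lprod u z f g : msmooth_at f u -> msmooth_at g u ->
  dfun ((fun u => lprod (f u) (g u)) : P -> R^o) u z
  = lprod (dfun f u z) (g u) + lprod (f u) (dfun g u z).
Proof.
move=> sf sg.
have lT : linear (fun v : L => v^T *m gram).
  by move=> a v w; rewrite linearP /= mulmxDl scalemxAl.
have l00 : linear (fun A : 'M[R]_1 => A 0 0 : R^o) by move=> a A B; rewrite !mxE.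
have sfT : msmooth_at (fun u => (f u)^T *m gram) u.
  exact: smooth_at_lin (@findim_mx R _ _) lT sf.
have dfT := dfun_lin_comp z (@findim_mx R _ _) lT sf.
have sp : msmooth_at (fun u => (f u)^T *m gram *m g u) u by exact: smooth_at_mulmx.
apply: etrans (dfun_lin_comp z (@findim_mx R _ _) l00 sp) _.
by rewrite (dfun_mulmx_eq sfT sg dfT erefl) mxE.
Qed.

Lemma msmooth_lprod u f g : msmooth_at f u -> msmooth_at g u ->
  msmooth_at ((fun u => lprod (f u) (g u)) : P -> R^o) u.
Proof.
move=> sf sg; apply: smooth_at_coord; apply: smooth_at_mulmx => //.
by apply: smooth_at_mulmx; [exact: smooth_at_tr | exact: smooth_at_cst].
Qed.

Lemma nabla_metric u v f g : tractor_section f -> tractor_section g ->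
  dfun ((fun u => lprod (f u) (g u)) : P -> R^o) u (Defs.lift u v)
  = lprod (nabla_at omega u v f) (g u) + lprod (f u) (nabla_at omega u v g).
Proof.
move=> tf tg; rewrite dfun_lprod; [|exact: tractor_smooth..].
rewrite /nabla_at lprodDl lprodDr (gLie_skew _ _ (omega_gLie homega u _)).
by rewrite addrACA addNr addr0.
Qed.

(** Inverse of Phi on equivariant maps into the orthogonal complement of [ell]: the equation is
    solved at the chosen point of each fibre, and equivariance carries it to the others. For such
    maps a solution exists, so the default 0 is not reached. *)
Definition Phi_desc (t : P -> L) x : TN :=
  xget 0 [set v | Phi_at omega (fibre_pt P x) v = t (fibre_pt P x)].

Lemma Phi_descE (t : P -> L) u :
  (forall u h, Hset R m h -> t (act u h) = invmx h *m t u) ->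
  (forall u, lprod ell (t u) = 0) ->
  Phi_at omega u (Phi_desc t (prj u)) = t u.
Proof.
move=> tH tl; set u0 := fibre_pt P (prj u).
have pf : prj u0 = prj u by rewrite /u0 /fibre_pt; case: cid.
have [h Hh uE] := act_trans pf.
rewrite uE Phi_at_act // tH //; congr (_ *m _); rewrite -uE /Phi_desc -/u0.
have [a [X [b tE]]] := lcol_surj (t u0).
have b0 : b = 0 by have := tl u0; rewrite tE lprod_ell_lcol.
have [v vE] := Phi_at_surj homega u0 a X.
by case: xgetP => // /(_ v) /=; rewrite vE tE b0.
Qed.

Variable tau : N -> TN -> R.
Hypothesis htau : Sforms omega tau.
Local Notation et := (eta omega tau).

Lemma nabla_eta_eta u v : lprod (nabla_at omega u v et) (et u) = 0.
Proof.
have te := tractor_eta homega htau.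
have := nabla_metric u v te te; rewrite [X in _ + X]lprodC.
have -> : (fun u => lprod (et u) (et u)) = fun=> 0.
  by apply/funext => u'; rewrite eta_null.
by rewrite (dfun_cst (0 : R^o)) => H; lra.
Qed.

Lemma ell_nabla_eta u v : lprod ell (nabla_at omega u v et) = - tau (prj u) v.
Proof.
have te := tractor_eta homega htau.
have := nabla_metric u v (@tractor_xi R m k N P) te.
have -> : (fun u => lprod (xi u) (et u)) = fun=> 1.
  by apply/funext => u'; rewrite lprod_ell_eta.
rewrite (dfun_cst (1 : R^o)) -[nabla_at omega u v (@xi _ _ _ _ P)]/(Phi_at omega u v).
by rewrite lprod_Phi_eta // => /esym/eqP; rewrite addrC addr_eq0 => /eqP.
Qed.

(** The derivative of eta pairs with [ell] to -tau(v); adding tau(v) eta cancels this and brings the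
    sum into the image of Phi. The sum stays orthogonal to eta, which places its preimage in the
    kernel of tau. *)
Definition Deta x v : TN :=
  Phi_desc (fun u => nabla_at omega u v et + tau (prj u) v *: et u) x.

Lemma Phi_Deta u v : Phi_at omega u (Deta (prj u) v) =
  nabla_at omega u v et + tau (prj u) v *: et u.
Proof.
have te := tractor_eta homega htau.
apply: (Phi_descE (t := fun u => nabla_at omega u v et + tau (prj u) v *: et u)) => u'.
  by move=> h Hh; rewrite nabla_at_act // act_proj // te.2 // [RHS]mulmxDr -scalemxAr.
by rewrite lprodDr lprodZr ell_nabla_eta lprod_ell_eta // mulr1 addNr.
Qed.

Lemma vsmooth_coord_vec (c : chart R N m.+1) (e : TN) x : atlas c -> cdom c x ->
  vsmooth_at (fun y => coord_vec c y e) x.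
Proof.
move=> ac cx; apply: (msmooth_at_dfun ac cx).
  apply: (@msmooth_at_eq _ _ _ _ (fun=> e)); last exact: smooth_at_cst.
  by apply: filterS (near_cdom cx) => y cy; rewrite coord_vecK.
exact: msmooth_at_cmap (chart_at_atlas x) (chart_at_dom x).
Qed.

Lemma Deta_morphism : bundle_morphism_An tau Deta.
Proof.
have te := tractor_eta homega htau.
split; last first.
  move=> x v; have [u <-] := proj_surj P x.
  rewrite /An /= -(lprod_Phi_eta homega htau) Phi_Deta lprodDl lprodZl.
  by rewrite nabla_eta_eta eta_null // mulr0 addr0.
split=> [x|c ac e].
  have [u <-] := proj_surj P x; move=> a v w; apply: (Phi_at_inj homega (u := u)).
  rewrite Phi_atD // Phi_atZ // !Phi_Deta (nabla_at_linear homega u te) /= (tauD htau) (tauZ htau).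
  move: (nabla_at _ _ v _) (nabla_at _ _ w _) => n1 n2.
  by rewrite scalerDl -scalerA scalerDr addrACA.
apply/smooth_fun_onP => [|x cx]; first exact: cdom_open.
have [u ux] := proj_surj P x; rewrite -ux in cx *.
apply: (smooth_of_Phi homega ac cx).
have -> : (fun u' => Phi_at omega u' (Deta (prj u') (coord_vec c (prj u') e)))
    = fun u' => nabla_at omega u' (coord_vec c (prj u') e) et
                + tau (prj u') (coord_vec c (prj u') e) *: et u'.
  by apply/funext => u'; exact: Phi_Deta.
have sW := vsmooth_coord_vec e ac cx.
apply: smooth_atD; first exact: nabla_at_smooth sW te.
apply: smooth_atZ; last exact: (tractor_smooth u te).
apply: (msmooth_at_comp (proj_smooth_at u)
  (f := (fun y => tau y (coord_vec c y e)) : N -> R^o)).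
have [[_ st] _] := htau.
have /smooth_fun_onP := st c ac e.
by move=> /(_ (cdom_open c)) /(_ _ cx).
Qed.

(* Orthogonal projection along the hyperbolic plane spanned by [ell] and [et u]. *)
Definition An_part u (e : L) : L :=
  e - lprod e (et u) *: ell - lprod ell e *: et u.

Lemma An_part_split u e :
  e = An_part u e + lprod e (et u) *: ell + lprod ell e *: et u.
Proof. by rewrite /An_part addrAC !subrK. Qed.

Lemma An_part_linear u : linear (An_part u).
Proof.
move=> a e e'; rewrite /An_part !lprodDl !lprodZl !lprodDr !lprodZr.
by apply/colP => i; rewrite !mxE; ring.
Qed.

Lemma An_partD u e e' : An_part u (e + e') = An_part u e + An_part u e'.
Proof. by have := An_part_linear u 1 e e'; rewrite !scale1r. Qed.

Lemma An_partZ u a e : An_part u (a *: e) = a *: An_part u e.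
Proof. by have [t tE] := linear_packed (@An_part_linear u); rewrite tE linearZ. Qed.

Lemma lprod_ell_ell : lprod ell (ell : L) = 0.
Proof. by rewrite /ell lprod_ell_lcol. Qed.

Lemma ell_An_part u e : lprod ell (An_part u e) = 0.
Proof.
have := congr1 (lprod ell) (An_part_split u e).
by rewrite !lprodDr !lprodZr lprod_ell_ell lprod_ell_eta // => ?; lra.
Qed.

Lemma An_part_eta u e : lprod (An_part u e) (et u) = 0.
Proof.
have := congr1 (lprod ^~ (et u)) (An_part_split u e).
by rewrite !lprodDl !lprodZl eta_null // lprod_ell_eta // => ?; lra.
Qed.

Lemma An_part_act u h e : Hset R m h ->
  An_part (act u h) (invmx h *m e) = invmx h *m An_part u e.
Proof.
move=> Hh; have te := tractor_eta homega htau.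
rewrite /An_part te.2 // lprod_invmx // -{1 2}(invmx_ell Hh) lprod_invmx //.
by rewrite !scalemxAr -!mulmxBr.
Qed.

Lemma An_part_Phi u v : An tau (prj u) v ->
  An_part u (Phi_at omega u v) = Phi_at omega u v.
Proof.
move=> Av; rewrite /An_part lprod_Phi_eta // lprod_ell_Phi // Av.
by rewrite !scale0r !subr0.
Qed.

Lemma An_part_lprod u e v : An tau (prj u) v ->
  lprod (An_part u e) (Phi_at omega u v) = lprod e (Phi_at omega u v).
Proof.
move=> Av; have := congr1 (lprod ^~ (Phi_at omega u v)) (An_part_split u e).
rewrite !lprodDl !lprodZl lprod_ell_Phi // [lprod (et u) _]lprodC lprod_Phi_eta // Av.
by move=> ?; lra.
Qed.

(** Tangential part of the ambient derivative, as in the Gauss formula: orthogonal projection of a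
    metric connection to a nondegenerate subbundle is again a metric connection. *)
Definition nabAn (W X : N -> TN) : N -> TN :=
  Phi_desc (fun u => An_part u (nablaT omega W (Phi omega X) u)).

Lemma Phi_nabAn (W X : N -> TN) u : smooth_vfield W -> smooth_vfield X ->
  Phi_at omega u (nabAn W X (prj u)) =
  An_part u (nabla_at omega u (W (prj u)) (Phi omega X)).
Proof.
move=> sW sX; rewrite /nabAn Phi_descE // => [u' h Hh|u']; last exact: ell_An_part.
by rewrite (tractor_nablaT sW (tractor_Phi sX)).2 // An_part_act.
Qed.

(* Keeps unification from unfolding the choice in [nabAn]. *)
#[local] Opaque nabAn.

Lemma nabAn_section (W X : N -> TN) : smooth_vfield W -> smooth_vfield X ->
  An_section tau (nabAn W X).
Proof.
move=> sW sX; have te := tractor_eta homega htau.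
have tP := tractor_nablaT sW (tractor_Phi sX).
split; last first.
  move=> x; have [u <-] := proj_surj P x.
  by rewrite /An /= -(lprod_Phi_eta homega htau) Phi_nabAn // An_part_eta.
move=> c ac; apply/smooth_fun_onP => [|x cx]; first exact: cdom_open.
have [u ux] := proj_surj P x; rewrite -ux in cx *.
apply: (smooth_of_Phi homega ac cx).
have -> : (fun u' => Phi_at omega u' (nabAn W X (prj u')))
    = fun u' => An_part u' (nablaT omega W (Phi omega X) u').
  by apply/funext => u'; exact: Phi_nabAn.
have st := tractor_smooth u tP; have se := tractor_smooth u te.
have sl : msmooth_at (fun _ : P => ell : L) u by exact: smooth_at_cst.
apply: (@msmooth_at_eq _ _ _ _ (fun u' => nablaT omega W (Phi omega X) u'
  + (- lprod (nablaT omega W (Phi omega X) u') (et u')) *: ell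
  + (- lprod ell (nablaT omega W (Phi omega X) u')) *: et u')).
  by apply: filterE => u'; rewrite /An_part !scaleNr.
have lN : linear (fun a : R^o => - a) by move=> a b c'; rewrite opprD scalerN.
apply: smooth_atD; first apply: smooth_atD => //.
  apply: smooth_atZ => //.
  exact: smooth_at_lin (@findim_R R) lN (msmooth_lprod st se).
apply: smooth_atZ => //.
exact: smooth_at_lin (@findim_R R) lN (msmooth_lprod sl st).
Qed.

Lemma smooth_vfieldD (W W' : N -> TN) : smooth_vfield W -> smooth_vfield W' ->
  smooth_vfield (fun y => W y + W' y).
Proof.
move=> sW sW' c ac; have oc := cdom_open c; apply/smooth_fun_onP => // x cx.
have /smooth_fun_onP := sW c ac; move=> /(_ oc) /(_ x cx) sWx.
have /smooth_fun_onP := sW' c ac; move=> /(_ oc) /(_ x cx) sWx'.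
apply: (@msmooth_at_eq _ _ _ _ (fun y => dfun c y (W y) + dfun c y (W' y))).
  apply: filterE => y; have [d dE] := linear_packed (@dfun_linear _ _ _ _ c y).
  by rewrite dE linearD.
exact: smooth_atD.
Qed.

Lemma smooth_vfieldZ (a : N -> R) (W : N -> TN) : smoothR a -> smooth_vfield W ->
  smooth_vfield (fun y => a y *: W y).
Proof.
move=> /smooth_funP sa sW c ac; have oc := cdom_open c; apply/smooth_fun_onP => // x cx.
have /smooth_fun_onP := sW c ac; move=> /(_ oc) /(_ x cx) sWx.
apply: (@msmooth_at_eq _ _ _ _ (fun y => a y *: dfun c y (W y))).
  apply: filterE => y; have [d dE] := linear_packed (@dfun_linear _ _ _ _ c y).
  by rewrite dE linearZ.
by apply: smooth_atZ => //; exact: sa.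
Qed.

Lemma PhiE W u : Phi omega W u = Phi_at omega u (W (prj u)).
Proof. by []. Qed.

Lemma nabAn_connection : linear_connection_An tau nabAn.
Proof.
split.
- by move=> W X sW [sX _]; exact: nabAn_section.
- move=> W W' X a sW sW' sa [sX AX] x; have [u <-] := proj_surj P x.
  apply: (Phi_at_inj homega (u := u)); rewrite Phi_atD // Phi_atZ //.
  have sWW := smooth_vfieldD (smooth_vfieldZ sa sW) sW'.
  rewrite [LHS](Phi_nabAn u sWW sX) [X in _ = _ *: X + _](Phi_nabAn u sW sX).
  rewrite [X in _ = _ + X](Phi_nabAn u sW' sX).
  by rewrite (nabla_at_linear homega u (tractor_Phi sX)) /= An_partD An_partZ.
- move=> W X Y sW [sX AX] [sY AY] x; have [u <-] := proj_surj P x.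
  apply: (Phi_at_inj homega (u := u)); rewrite Phi_atD //.
  rewrite [LHS](Phi_nabAn u sW (smooth_vfieldD sX sY)).
  rewrite [X in _ = X + _](Phi_nabAn u sW sX) [X in _ = _ + X](Phi_nabAn u sW sY).
  rewrite -An_partD -nabla_atD; [|exact: tractor_Phi..]; congr (An_part u _).
  by congr nabla_at; apply/funext => u'; rewrite !PhiE Phi_atD.
- move=> W X a sW sa [sX AX] x; have [u <-] := proj_surj P x.
  apply: (Phi_at_inj homega (u := u)); rewrite Phi_atD // !Phi_atZ //.
  rewrite [LHS](Phi_nabAn u sW (smooth_vfieldZ sa sX)).
  rewrite [X in _ = _ + _ *: X](Phi_nabAn u sW sX).
  (* In the Leibniz rule the derivative of the coefficient multiplies Phi(X) itself, which [An_part]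
     fixes since X lies in the kernel of tau. *)
  rewrite -[in RHS](@An_part_Phi u (X (prj u))); last exact: AX.
  rewrite -!An_partZ -An_partD -nabla_atZ //; last exact: tractor_Phi.
  by congr (An_part u _); congr nabla_at; apply/funext => u'; rewrite !PhiE Phi_atZ.
Qed.

Lemma nabAn_metric : metric_connection_An omega tau nabAn.
Proof.
split; first exact: nabAn_connection.
move=> W X Y sW AX AY x; have [u <-] := proj_surj P x.
have [sX _] := AX; have [sY _] := AY.
have [tX tY] := (tractor_Phi sX, tractor_Phi sY).
have hE : (fun y => hmet omega y (X y) (Y y)) \o prj
    = fun u => lprod (Phi omega X u) (Phi omega Y u).
  by apply/funext => u' /=; rewrite hmetE.
(* The chain rule through the projection requires h(X, Y) to be smooth on N. Upstairs it is a
   pairing of tractor sections, hence smooth, and this descends. *)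
have sh : msmooth_at ((fun y => hmet omega y (X y) (Y y)) : N -> R^o) (prj u).
  apply: msmooth_at_descent; rewrite hE.
  by apply: msmooth_lprod; exact: tractor_smooth.
have E1 : hmet omega (prj u) (nabAn W X (prj u)) (Y (prj u))
    = lprod (nabla_at omega u (W (prj u)) (Phi omega X)) (Phi omega Y u).
  by rewrite (hmetE homega) Phi_nabAn // An_part_lprod //; case: AY.
have E2 : hmet omega (prj u) (X (prj u)) (nabAn W Y (prj u))
    = lprod (Phi omega X u) (nabla_at omega u (W (prj u)) (Phi omega Y)).
  rewrite (hmetE homega) Phi_nabAn // lprodC An_part_lprod //; last by case: AX.
  exact: lprodC.
rewrite E1 E2 -(nabla_metric u _ tX tY) -hE.
rewrite (dfun_comp (proj_smooth_at u) _ sh) tmap_lift.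
by [].
Qed.

Lemma nablaT_decomp (W X : N -> TN) (alpha beta : N -> R) :
  smooth_vfield W -> smoothR alpha -> smoothR beta -> An_section tau X ->
  nablaT omega W (decomp omega tau alpha X beta)
  = decomp omega tau
      (fun x => vder W alpha x + alpha x * tau x (W x) - hmet omega x (X x) (Deta x (W x)))
      (fun x => alpha x *: Ptau omega tau x (W x) + beta x *: Deta x (W x) + nabAn W X x)
      (fun x => vder W beta x - beta x * tau x (W x) - hmet omega x (X x) (W x)).
Proof.
move=> sW sa sb AX; have [sX AnX] := AX; apply/funext => u.
have te := tractor_eta homega htau; have tX := tractor_Phi sX.
have txi := @tractor_xi R m k N P.
set v := W (prj u).
have tZ (a : N -> R) f : smoothR a -> tractor_section f ->
    tractor_section (fun u => a (prj u) *: f u).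
  move=> sa' tf; split=> [|u' h Hh].
    apply/smooth_funP => u'; apply: smooth_atZ; last exact: tractor_smooth.
    apply: (msmooth_at_comp (proj_smooth_at u') (f := (a : N -> R^o))).
    by move/smooth_funP: sa'; apply.
  by rewrite act_proj // tf.2 // scalemxAr.
have tD f g : tractor_section f -> tractor_section g ->
    tractor_section (fun u => f u + g u).
  move=> tf tg; split=> [|u' h Hh]; last by rewrite tf.2 // tg.2 // mulmxDr.
  by apply/smooth_funP => u'; apply: smooth_atD; exact: tractor_smooth.
have LE : nablaT omega W (decomp omega tau alpha X beta) u =
    vder W alpha (prj u) *: ell + alpha (prj u) *: Phi_at omega u v
    + nabla_at omega u v (Phi omega X)
    + (vder W beta (prj u) *: et u + beta (prj u) *: nabla_at omega u v et).
  rewrite -[LHS]/(nabla_at omega u v (fun u =>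
    alpha (prj u) *: xi u + Phi omega X u + beta (prj u) *: et u)).
  rewrite (nabla_atD _ _ (tD _ _ (tZ _ _ sa txi) tX) (tZ _ _ sb te)).
  by rewrite (nabla_atD _ _ (tZ _ _ sa txi) tX) !nabla_atZ.
have PD := Phi_Deta u v.
have teta : lprod (nabla_at omega u v (Phi omega X)) (et u)
    = - hmet omega (prj u) (X (prj u)) (Deta (prj u) v).
  have := nabla_metric u v tX te.
  have -> : (fun u => lprod (Phi omega X u) (et u)) = fun=> 0.
    by apply/funext => u'; rewrite lprod_Phi_eta //; exact: AnX.
  rewrite (dfun_cst (0 : R^o)) (hmetE homega) PD lprodDr lprodZr.
  by rewrite lprod_Phi_eta // AnX mulr0 addr0 => H; apply/eqP; rewrite -addr_eq0 -H.
have tell : lprod ell (nabla_at omega u v (Phi omega X))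
    = - hmet omega (prj u) (X (prj u)) v.
  have := nabla_metric u v txi tX.
  have -> : (fun u => lprod (xi u) (Phi omega X u)) = fun=> 0.
    by apply/funext => u'; rewrite lprod_ell_Phi.
  rewrite (dfun_cst (0 : R^o)) (hmetE homega) => /esym/eqP.
  rewrite addrC addr_eq0 => /eqP H.
  exact: etrans H (congr1 -%R (lprodC _ _)).
(* Phi(W) = Phi(P W) + tau(W) ell produces the term alpha tau(W) of the first row, and the
   derivative of eta, equal to Phi(D W) - tau(W) eta, produces -beta tau(W) in the last one. *)
rewrite LE (An_part_split u (nabla_at omega u v (Phi omega X))) teta tell.
rewrite /decomp PhiE !Phi_atD // !Phi_atZ // (Phi_nabAn u sW sX) -/v PD.
rewrite (Phi_at_split homega tau u v) /xi.
(* Once the vectors and scalars are abstracted, the two sides are the same linear combination,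
   compared coordinate by coordinate. *)
move: (An_part u _) (nabla_at omega u v et) (Phi_at omega u _) (et u) => e1 e2 e3 e4.
move: (vder W alpha _) (vder W beta _) (hmet _ _ _ _) (hmet _ _ _ _) => r1 r2 r3 r4.
by apply/colP => i; rewrite !mxE; ring.
Qed.

End TractorCalculus.

Theorem proposition6p5 (R : realType) (m k : nat) (hm : (2 <= m)%N)
    (N : manifold R m.+1) (hN : connected [set: N])
    (P : principal_Hbundle k N)
    (omega : P -> 'rV[R]_k -> 'M[R]_(1 + (m + 1)))
    (homega : lightlike_cartan omega)
    (tau : N -> 'rV[R]_m.+1 -> R) (htau : Sforms omega tau) :
  exists (nab : (N -> 'rV[R]_m.+1) -> (N -> 'rV[R]_m.+1) -> (N -> 'rV[R]_m.+1))
         (D : N -> 'rV[R]_m.+1 -> 'rV[R]_m.+1),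
    metric_connection_An omega tau nab /\ bundle_morphism_An tau D /\
    forall (W : N -> 'rV[R]_m.+1) (alpha beta : N -> R) (X : N -> 'rV[R]_m.+1),
      smooth_vfield W -> smoothR alpha -> smoothR beta -> An_section tau X ->
      nablaT omega W (decomp omega tau alpha X beta)
      = decomp omega tau
          (fun x => vder W alpha x + alpha x * tau x (W x)
                    - hmet omega x (X x) (D x (W x)))
          (fun x => alpha x *: Ptau omega tau x (W x) + beta x *: D x (W x)
                    + nab W X x)
          (fun x => vder W beta x - beta x * tau x (W x)
                    - hmet omega x (X x) (W x)).
Proof.
exists (nabAn omega tau), (Deta omega tau).
split; first exact: nabAn_metric.
split; first exact: Deta_morphism.
by move=> W alpha beta X sW sa sb AX; exact: nablaT_decomp.
Qed.
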